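(* Let $N\ge 3$ and $p\in(0,2)$. For $V\in H^1_\Gamma$ let $\langle \Lambda''(\Phi)V,V\rangle_{L^2(\Gamma)}:=\frac{d^2}{ds^2}\Lambda(\Phi+sV)\big|_{s=0}$ denote the second variation of $\Lambda$ at $\Phi$. Then $\langle \Lambda''(\Phi)V,V\rangle_{L^2(\Gamma)}\ge 0$ for every $V\in H^1_\Gamma\cap L^2_c$. Moreover, $\langle \Lambda''(\Phi)V,V\rangle_{L^2(\Gamma)}=0$ for $V\in H^1_\Gamma\cap L^2_c$ if and only if $V$ belongs to the $(N-1)$-dimensional subspace of $L^2_c$ spanned by the orthogonal set $\{U^{(1)},\dots,U^{(N-1)}\}$. Consequently, $V=0$ is a degenerate minimizer of $\langle \Lambda''(\Phi)V,V\rangle_{L^2(\Gamma)}$ in $H^1_\Gamma\cap L^2_c$.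
   Context: Let $N\ge 3$ and let $\Gamma$ be the star graph consisting of $N$ half-lines joined at a single vertex; each edge is parametrized by $x\in[0,\infty)$ with the vertex at $x=0$. Functions on $\Gamma$ are vectors $\Psi=(\psi_1,\dots,\psi_N)^T$ of complex-valued functions on $\mathbb{R}^+$; $L^2(\Gamma)=\oplus_{j=1}^N L^2(\mathbb{R}^+)$ with inner product $\langle F,G\rangle_{L^2(\Gamma)}=\sum_{j=1}^N\int_0^\infty f_j\overline{g_j}\,dx$, and $H^k(\Gamma)=\oplus_{j=1}^N H^k(\mathbb{R}^+)$. Let $H^1_\Gamma=\{\Psi\in H^1(\Gamma):\psi_1(0)=\dots=\psi_N(0)\}$. For $p>0$ define $E(\Psi)=\|\Psi'\|_{L^2(\Gamma)}^2-\|\Psi\|_{L^{2p+2}(\Gamma)}^{2p+2}$, $Q(\Psi)=\|\Psi\|^2_{L^2(\Gamma)}$, and $\Lambda(\Psi)=E(\Psi)+Q(\Psi)$. Let $\phi(x)=\operatorname{sech}^{1/p}(px)$ and $\Phi=\phi\,(1,1,\dots,1)^T$ (the half-soliton state). Let $L^2_c=\{V\in L^2(\Gamma):\langle V,\Phi\rangle_{L^2(\Gamma)}=0\}$. For $k=1,\dots,N-1$ let $e_k\in\mathbb{R}^N$ be the vector whose first $k$ entries equal $1$, whose $(k+1)$-th entry equals $-k$, and whose remaining entries are $0$, and set $U^{(k)}(x)=\phi'(x)e_k$ (real-valued). The subspace spanned is taken over the real numbers. *)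

(* Defs.v *)
From HB Require Import structures.
From mathcomp Require Import all_boot all_order all_algebra.
From mathcomp Require Import all_classical all_reals all_analysis.
Set Implicit Arguments. Unset Strict Implicit. Unset Printing Implicit Defensive.
Import Order.TTheory GRing.Theory Num.Theory.
Import numFieldNormedType.Exports.
Local Open Scope classical_set_scope.
Local Open Scope ring_scope.

Section Defs.
Variable R : realType.

Definition halfline : set R := `[0, +oo[%classic.

Local Notation mu := (@lebesgue_measure R).

(* integral over the half line, real-valued (all integrands below are integrable
   in the situations where they are used) *)
Definition hint (f : R -> R) : R := fine (\int[mu]_(x in halfline) (f x)%:E).

Definition L2 (f : R -> R) : Prop :=
  measurable_fun halfline f /\ (\int[mu]_(x in halfline) (f x ^+ 2)%:E < +oo)%E.

(* real H^1(R^+): f in L^2 with (weak) derivative df in L^2, f being the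
   absolutely continuous representative f x = f 0 + int_0^x df. *)
Definition H1 (f df : R -> R) : Prop :=
  L2 f /\ L2 df /\
  forall x, 0 <= x ->
    mu.-integrable `[0, x] (EFin \o df) /\
    f x = f 0 + fine (\int[mu]_(t in `[0, x]) (df t)%:E).

(* functions on the star graph with N edges: component j is a complex-valued
   function on R^+, encoded by (real part, imaginary part). *)
Definition gfun (N : nat) := 'I_N -> R -> R * R.

Definition gadd N (F G : gfun N) : gfun N :=
  fun j x => ((F j x).1 + (G j x).1, (F j x).2 + (G j x).2).
Definition gscale N (s : R) (F : gfun N) : gfun N :=
  fun j x => (s * (F j x).1, s * (F j x).2).

Definition in_H1 N (V dV : gfun N) : Prop :=
  forall j, H1 (fun x => (V j x).1) (fun x => (dV j x).1) /\
            H1 (fun x => (V j x).2) (fun x => (dV j x).2).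

Definition in_H1_Gamma N (V dV : gfun N) : Prop :=
  in_H1 V dV /\ forall i j, V i 0 = V j 0.

(* real and imaginary parts of <F,G>_{L^2(Gamma)} = sum_j int f_j conj(g_j) *)
Definition ip_re N (F G : gfun N) : R :=
  \sum_(j < N) hint (fun x => (F j x).1 * (G j x).1 + (F j x).2 * (G j x).2).
Definition ip_im N (F G : gfun N) : R :=
  \sum_(j < N) hint (fun x => (F j x).2 * (G j x).1 - (F j x).1 * (G j x).2).

Definition L2orth N (F G : gfun N) : Prop := ip_re F G = 0 /\ ip_im F G = 0.

Definition abs2 (z : R * R) : R := z.1 ^+ 2 + z.2 ^+ 2.

(* Lambda(Psi) = ||Psi'||^2 - ||Psi||_{2p+2}^{2p+2} + ||Psi||^2, where dPsi is
   the weak derivative of Psi *)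
Definition Lambda (p : R) N (Psi dPsi : gfun N) : R :=
  \sum_(j < N) (hint (fun x => abs2 (dPsi j x))
                - hint (fun x => powR (abs2 (Psi j x)) (p + 1))
                + hint (fun x => abs2 (Psi j x))).

(* phi(x) = sech^{1/p}(p x) *)
Definition phi (p : R) (x : R) : R :=
  powR (2 / (expR (p * x) + expR (- (p * x)))) p^-1.

Definition Phi (p : R) N : gfun N := fun _ x => (phi p x, 0).
Definition dPhi (p : R) N : gfun N := fun _ x => (derive1 (phi p) x, 0).

Definition second_var (p : R) N (V dV : gfun N) : R :=
  (derive1 (derive1 (fun s : R =>
     Lambda p (gadd (@Phi p N) (gscale s V)) (gadd (@dPhi p N) (gscale s dV))))) 0.

(* e_k (k = 1..N-1, here k : 'I_(N-1) encodes k.+1): first k entries 1,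
   (k+1)-th entry -k, rest 0 *)
Definition ek N (k : 'I_(N.-1)) (j : 'I_N) : R :=
  if (j < k.+1)%N then 1 else if j == k.+1 :> nat then - (k.+1)%:R else 0.

Definition U (p : R) N (k : 'I_(N.-1)) : gfun N :=
  fun j x => (ek k j * derive1 (phi p) x, 0).
Definition dU (p : R) N (k : 'I_(N.-1)) : gfun N :=
  fun j x => (ek k j * derive1 (derive1 (phi p)) x, 0).

Definition in_span_U (p : R) N (V : gfun N) : Prop :=
  exists c : 'I_(N.-1) -> R, forall j x, 0 <= x ->
    V j x = (\sum_(k < N.-1) c k * (U p k j x).1, 0).

End Defs.
Arguments Phi {R} p N _ _.
Arguments dPhi {R} p N _ _.

(* Main.v *)
(** The second variation splits as [2 * sum_j (Q+(Re V_j) + Q-(Im V_j))] with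
    [Q+(v) = int v'^2 + W+ v^2] and [Q-(v) = int v'^2 + W- v^2], where [dphi] and [phi]
    solve [psi'' = W+ psi] and [psi'' = W- psi]. If [psi'' = W psi], [psi] has no zero on
    the open half line and [r = psi' / psi], then [(v' - r v)^2 = v'^2 + W v^2 - (r v^2)'],
    so the form is nonnegative as soon as the boundary terms vanish, with equality only
    for multiples of [psi]. This settles [Q-], and it settles [Q+] for functions that vanish
    at the vertex, where [r] behaves like [1 / x]. For a common nonzero value at the
    vertex one subtracts from every [Re V_j] the same multiple [c * theta] of
    [theta = phi / (2 p) + x phi' / 2], which solves [- theta'' + W+ theta = - phi] with
    [theta' 0 = 0]: the orthogonality to [Phi] kills the cross terms, and what is left is
    [N c^2 <theta, phi>], which is positive exactly because [p < 2]. *)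

Require Import Defs.
From HB Require Import structures.
From mathcomp Require Import all_boot all_order all_algebra.
From mathcomp Require Import all_classical all_reals all_analysis.
From mathcomp Require Import measurable_realfun ring lra.
Import Order.TTheory GRing.Theory Num.Theory.
Import numFieldNormedType.Exports.
Set Implicit Arguments. Unset Strict Implicit. Unset Printing Implicit Defensive.
Local Open Scope classical_set_scope.
Local Open Scope ring_scope.

(** * Square-integrable functions *)

Section Integrals.
Variable R : realType.
Local Notation mu := (@lebesgue_measure R).
Local Notation msb A := (@measurable _ (measurableTypeR R) A).
Implicit Types (A : set R) (f g h : R -> R) (a b c x y : R).

(** The second variation is a genuine second derivative in [s], so Lambda (Phi + s V) has to be
    differentiated twice under the integral. The obstacle is [powR] where Phi + s V vanishes: there
    |Phi + s V|^2 is a multiple of a perfect square in s, and Cauchy-Schwarz absorbs the power p -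
    1, singular for p < 1, into a power p. The derivative [dV] may be any weak derivative. Functions
    are therefore handled through their increments, with a product rule proved by bisection, and the
    vanishing of the form on the span first requires that the form be independent of the choice of
    [dV]. The function theta comes from the family omega^(1/(2p)) phi (sqrt omega x) of solitons of
    frequency omega: differentiating their equation in omega at 1 gives the equation of theta, and
    differentiating the formula gives its two coefficients. The number <theta, phi> = (1/(2p) - 1/4)
    ||phi||^2 is half the derivative in omega of the squared norm, which is the slope condition for
    stability. *)

Definition itg A f := mu.-integrable A (EFin \o f).

Lemma itg_measurable A f : itg A f -> measurable_fun A f.
Proof. by move=> /integrableP[/measurable_EFinP]. Qed.

Lemma itg_dom A f g : msb A -> measurable_fun A f -> itg A g ->
  (forall x, A x -> `|f x| <= g x) -> itg A f.
Proof.
move=> mA mf ig fg; apply: le_integrable ig => //; first exact/measurable_EFinP.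
move=> x Ax /=; rewrite lee_fin; apply: le_trans (fg _ Ax) _; exact: ler_norm.
Qed.

Lemma itgD A f g : msb A -> itg A f -> itg A g -> itg A (fun x => f x + g x).
Proof.
move=> mA If Ig; apply: (eq_integrable mA ((EFin \o f) \+ (EFin \o g))%E); last exact: integrableD.
by move=> x _; rewrite /= EFinD.
Qed.

Lemma itgZ A f c : msb A -> itg A f -> itg A (fun x => c * f x).
Proof.
move=> mA If; apply: (eq_integrable mA (fun x => c%:E * (EFin \o f) x)%E); last exact: integrableZl.
by move=> x _; rewrite /= EFinM.
Qed.

Lemma itgB A f g : msb A -> itg A f -> itg A g -> itg A (fun x => f x - g x).
Proof.
move=> mA If Ig; have := itgD mA If (itgZ (-1) mA Ig).
by apply: (eq_integrable mA (EFin \o _)) => x _ /=; rewrite mulN1r.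
Qed.

Lemma itg_sub A (B : set R) f : msb A -> msb B -> B `<=` A -> itg A f -> itg B f.
Proof. by move=> mA mB BA If; exact: (integrableS mA mB BA If). Qed.

Lemma itg_eq A f g : msb A -> (forall x, A x -> f x = g x) -> itg A f -> itg A g.
Proof.
by move=> mA fg; apply: (eq_integrable mA) => x /set_mem /fg /= ->.
Qed.

Lemma itg_norm A f : msb A -> itg A f -> itg A (fun x => `|f x|).
Proof.
move=> mA If; apply: (itg_dom (g := fun x => `|f x|)) => //.
- by apply: measurableT_comp => //; exact: itg_measurable.
- by have := integrable_abse If.
- by move=> x _; rewrite normr_id.
Qed.

Lemma itg_cst a b c : itg `[a, b] (fun=> c).
Proof.
apply/integrableP; split; first exact/measurable_EFinP.
rewrite /= integral_cst//= lebesgue_measure_itv/=.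
by case: ifP => _; rewrite ltry.
Qed.

Definition sqi A f := measurable_fun A f /\ itg A (fun x => f x ^+ 2).

Lemma sqi_mul A f g : msb A -> sqi A f -> sqi A g -> itg A (fun x => f x * g x).
Proof.
move=> mA [mf If] [mg Ig]; apply: (itg_dom mA _ (itgD mA If Ig)).
  exact: measurable_funM.
move=> x _; rewrite normrM -(real_normK (num_real (f x))) -(real_normK (num_real (g x))).
have := sqr_ge0 (`|f x| - `|g x|).
have := normr_ge0 (f x); have := normr_ge0 (g x).
set u := `|f x|; set v := `|g x|. nra.
Qed.

Lemma sqi_lin A f g c d : msb A -> sqi A f -> sqi A g ->
  sqi A (fun x => c * f x + d * g x).
Proof.
move=> mA sf sg; have [[mf If] [mg Ig]] := (sf, sg); split.
  by apply: measurable_funD; apply: measurable_funM.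
have := itgD mA (itgD mA (itgZ (c ^+ 2) mA If) (itgZ (d ^+ 2) mA Ig))
  (itgZ (2 * c * d) mA (sqi_mul mA sf sg)).
by apply: itg_eq => // x _; ring.
Qed.

Lemma sqi_eq A f g : msb A -> (forall x, A x -> f x = g x) -> sqi A f -> sqi A g.
Proof.
move=> mA fg [mf If]; split.
  by apply: eq_measurable_fun mf => x /set_mem /fg ->.
by apply: itg_eq If => // x /fg ->.
Qed.

Lemma sqi_sub A (B : set R) f : msb A -> msb B -> B `<=` A -> sqi A f -> sqi B f.
Proof.
move=> mA mB BA [mf If]; split; first exact: measurable_funS mf.
exact: itg_sub If.
Qed.

Lemma sqi_bmul A f g c : msb A -> measurable_fun A g ->
  (forall x, A x -> `|g x| <= c) -> sqi A f -> sqi A (fun x => g x * f x).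
Proof.
move=> mA mg gc [mf If]; split; first exact: measurable_funM.
apply: (itg_dom mA _ (itgZ (c ^+ 2) mA If)).
  by apply: measurable_funX; exact: measurable_funM.
move=> x Ax; rewrite ger0_norm ?sqr_ge0// exprMn ler_wpM2r ?sqr_ge0//.
rewrite -(real_normK (num_real (g x))); have := gc _ Ax; have := normr_ge0 (g x).
set u := `|g x|; nra.
Qed.

Lemma itg_bmul A f g c : msb A -> measurable_fun A g ->
  (forall x, A x -> `|g x| <= c) -> itg A f -> itg A (fun x => g x * f x).
Proof.
move=> mA mg gc If; apply: (itg_dom mA _ (itgZ c mA (itg_norm mA If))).
  by apply: measurable_funM => //; exact: itg_measurable.
by move=> x Ax; rewrite normrM ler_wpM2r// gc.
Qed.

Lemma sqi_itg a b f : sqi `[a, b] f -> itg `[a, b] f.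
Proof.
move=> [mf If]; have mA : msb `[a, b]%classic by [].
apply: (itg_dom mA mf (itgD mA (itg_cst a b 1) If)) => x _.
rewrite -(real_normK (num_real (f x))); set u := `|f x|.
have := sqr_ge0 (u - 1); nra.
Qed.

Lemma itv_sub a b c d : c <= a -> b <= d -> (`[a, b] `<=` `[c, d])%classic.
Proof.
by move=> ca bd x /=; rewrite !in_itv/= => /andP[? ?]; rewrite (le_trans ca)// (le_trans _ bd).
Qed.

Lemma Rint_split a b c f : a <= b -> b <= c -> itg `[a, c] f ->
  \int[mu]_(x in `[a, c]) f x = \int[mu]_(x in `[a, b]) f x + \int[mu]_(x in `[b, c]) f x.
Proof.
move=> ab bc If.
have E := @Rintegral_itvB R f (BLeft a) (BRight c) b If _ _.
rewrite !bnd_simp in E; have {}E := E ab bc.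
rewrite Rintegral_itv_obnd_cbnd in E; first by lra.
apply: itg_sub If => // x /=; rewrite !in_itv/= => /andP[bx ->].
by rewrite (le_trans ab (ltW bx)).
Qed.

Lemma Rint_cst a b c : a <= b -> \int[mu]_(x in `[a, b]) c = c * (b - a).
Proof.
move=> ab; rewrite Rintegral_cst//= lebesgue_measure_itv/= lte_fin.
case: ltP => // ba; have -> : b = a by apply/eqP; rewrite eq_le ab ba.
by rewrite subrr.
Qed.

Lemma cauchy_schwarz_itv a b f : a <= b -> sqi `[a, b] f ->
  (\int[mu]_(x in `[a, b]) `|f x|) ^+ 2 <= (b - a) * \int[mu]_(x in `[a, b]) f x ^+ 2.
Proof.
move=> ab sf; have mA : msb `[a, b]%classic by [].
have If := itg_norm mA (sqi_itg sf).
have [_ If2] := sf.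
set F := Rintegral _ _ _; set G := Rintegral _ _ _.
have [E|anb] := eqVneq a b.
  have -> : F = 0 by rewrite /F -E set_itv1 Rintegral_set1.
  by rewrite E subrr expr0n mul0r.
have ba : 0 < b - a by rewrite subr_gt0 lt_neqAle anb.
(* The mean of [|f|]: integrating (|f| - m)^2 >= 0 with this m gives Cauchy-Schwarz. *)
pose m := F / (b - a).
have : 0 <= \int[mu]_(x in `[a, b]) (f x ^+ 2 + (- (2 * m) * `|f x| + m ^+ 2)).
  apply: Rintegral_ge0 => x _; rewrite -(real_normK (num_real (f x))).
  set u := `|f x|; have := sqr_ge0 (u - m); nra.
rewrite RintegralD//; last by apply: itgD => //; [exact: itgZ|exact: itg_cst].
rewrite RintegralD//; [|exact: itgZ|exact: itg_cst].
rewrite RintegralZl// Rint_cst// -/F -/G => H.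
have E : m * (b - a) = F by rewrite /m divfK// gt_eqF.
have : 0 <= (b - a) * (G + (- (2 * m) * F + m ^+ 2 * (b - a))).
  by apply: mulr_ge0 => //; exact: ltW.
rewrite -E; nra.
Qed.

End Integrals.

(** * Integration by parts for functions with a square-integrable derivative *)

Section AbsolutelyContinuous.
Variable R : realType.
Local Notation mu := (@lebesgue_measure R).
Local Notation msb A := (@measurable _ (measurableTypeR R) A).
Implicit Types (f g : R -> R) (a b x y : R).

(* Halving the interval [k] times improves the bound by a factor [2 ^ k]. *)
Lemma additive_eq0 (D m : R -> R -> R) a b : a <= b ->
  (forall x y z, a <= x -> x <= y -> y <= z -> z <= b -> D x z = D x y + D y z) ->
  (forall x y z, a <= x -> x <= y -> y <= z -> z <= b -> m x z = m x y + m y z) ->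
  (forall x y, a <= x -> x <= y -> y <= b -> `|D x y| <= (y - x) * m x y) ->
  D a b = 0.
Proof.
move=> ab addD addm Dm.
have H k x y : a <= x -> x <= y -> y <= b -> `|D x y| <= (y - x) * m x y / 2 ^+ k.
  elim: k x y => [|k IH] x y ax xy yb; first by rewrite expr0 divr1 Dm.
  pose c := (x + y) / 2.
  have xc : x <= c by rewrite /c; lra.
  have cy : c <= y by rewrite /c; lra.
  rewrite (addD x c y)// (addm x c y)//; apply: le_trans (ler_normD _ _) _.
  have := lerD (IH x c ax xc (le_trans cy yb)) (IH c y (le_trans ax xc) cy yb).
  move=> /le_trans; apply; rewrite exprS invfM.
  set e := (_ ^+ k)^-1; rewrite [X in _ <= X](_ : _ = (c - x) * m x c * e + (y - c) * m c y * e)//.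
  by rewrite /c; field.
have [//|D0] := eqVneq (D a b) 0; exfalso.
have n0 : 0 < `|D a b| by rewrite normr_gt0.
set C := (b - a) * m a b.
have C0 : 0 <= C by apply: le_trans (Dm a b _ _ _).
have := H (Num.bound (C / `|D a b|)) a b (lexx _) ab (lexx _); rewrite -/C.
set k := Num.bound _.
have kC : C / `|D a b| < k%:R by apply: archi_boundP; rewrite divr_ge0// ltW.
have k2 : k%:R <= 2 ^+ k :> R by rewrite -natrX ler_nat ltnW// ltn_expl.
have p2 : 0 < 2 ^+ k :> R by rewrite exprn_gt0.
rewrite ler_pdivlMr// leNgt => /negP; apply.
by rewrite mulrC -ltr_pdivrMr// (lt_le_trans kC).
Qed.

(** Absolute continuity of [f] with square-integrable derivative [g]. The increment formula is
    demanded on every subinterval, which makes restriction immediate. *)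
Definition ac2 a b f g := [/\ measurable_fun `[a, b] f, sqi `[a, b] g &
  forall x y, a <= x -> x <= y -> y <= b -> f y - f x = \int[mu]_(t in `[x, y]) g t].

Lemma ac2_sub a b c d f g : a <= c -> d <= b -> ac2 a b f g -> ac2 c d f g.
Proof.
move=> ac db [mf sg fg]; split.
- by apply: measurable_funS mf => //; exact: itv_sub.
- by apply: sqi_sub sg => //; exact: itv_sub.
- by move=> x y cx xy yd; apply: fg => //; [exact: le_trans cx|exact: le_trans db].
Qed.

(** This replaces continuity of [f] in all later estimates: with Cauchy-Schwarz, the oscillation is
    at most the square root of (b - a) times the integral of g^2. *)
Lemma ac2_osc a b f g s t : ac2 a b f g -> a <= s -> s <= b -> a <= t -> t <= b ->
  `|f t - f s| <= \int[mu]_(x in `[a, b]) `|g x|.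
Proof.
move=> fg; wlog st : s t / s <= t.
  move=> H as_ sb at_ tb; have [st|/ltW ts] := leP s t; first exact: H.
  by rewrite distrC; apply: H.
move=> as_ sb at_ tb; have [mf sg E] := fg; rewrite E//.
have Ig := sqi_itg sg.
have Is : itg `[s, t] g by apply: itg_sub Ig => //; exact: itv_sub.
apply: le_trans (le_normr_Rintegral _ Is) _ => //.
have mA : msb `[a, b]%classic by [].
have Ign := itg_norm mA Ig.
have Isb : itg `[s, b] (fun x => `|g x|) by apply: itg_sub Ign => //; exact: itv_sub.
rewrite (Rint_split as_ sb Ign) (Rint_split st tb Isb).
rewrite addrCA lerDl addr_ge0//; apply: Rintegral_ge0 => //.
Qed.

Lemma ac2_bounded a b f g : ac2 a b f g ->
  exists M, forall x, `[a, b]%classic x -> `|f x| <= M.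
Proof.
move=> fg; exists (`|f a| + \int[mu]_(x in `[a, b]) `|g x|) => x /=.
rewrite in_itv/= => /andP[ax xb].
have ab := le_trans ax xb.
have := ac2_osc fg (lexx a) ab ax xb.
move=> H; have := ler_normD (f a) (f x - f a); rewrite addrC subrK; lra.
Qed.

(** The defect [D x y] of the product formula is additive in the interval and at most (y - x) times
    the additive quantity [m x y], so [additive_eq0] makes it vanish. Square integrability of both
    derivatives is what supplies the extra factor y - x. *)
Lemma ac2_mul a b f g df dg : ac2 a b f df -> ac2 a b g dg ->
  ac2 a b (fun x => f x * g x) (fun x => g x * df x + f x * dg x).
Proof.
move=> fF gG; have [mf sf Ef] := fF; have [mg sg Eg] := gG.
have mA : msb `[a, b]%classic by [].
have [Mf bf] := ac2_bounded fF; have [Mg bg] := ac2_bounded gG.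
have S : sqi `[a, b] (fun x => g x * df x + f x * dg x).
  have := sqi_lin 1 1 mA (sqi_bmul mA mg bg sf) (sqi_bmul mA mf bf sg).
  by apply: sqi_eq => // x _; rewrite !mul1r.
split => //; first exact: measurable_funM.
move=> x y ax xy yb.
pose D x y := f y * g y - f x * g x - \int[mu]_(t in `[x, y]) (g t * df t + f t * dg t).
pose m x y := \int[mu]_(t in `[x, y]) (df t ^+ 2 + dg t ^+ 2).
have sub s t : x <= s -> t <= y -> (`[s, t] `<=` `[a, b])%classic.
  by move=> xs ty; apply: itv_sub; [exact: le_trans xs|exact: le_trans yb].
suff : D x y = 0 by move/subr0_eq.
apply: (@additive_eq0 D m) => // [s t u xs st tu uy|s t u xs st tu uy|s t xs st ty].
- rewrite /D (Rint_split st tu); first by ring.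
  by apply: itg_sub (sqi_itg S) => //; exact: sub.
- rewrite /m (Rint_split st tu)//.
  apply: itg_sub (itgD mA sf.2 sg.2) => //; exact: sub.
have as_ := le_trans ax xs; have tb := le_trans ty yb.
have fs := ac2_sub as_ tb fF; have gs := ac2_sub as_ tb gG.
have mB : msb `[s, t]%classic by [].
have [[mfs sfs _] [mgs sgs _]] := (fs, gs).
have Idf := sqi_itg sfs; have Idg := sqi_itg sgs.
have Igdf : itg `[s, t] (fun z => g z * df z).
  by apply: (itg_bmul (c := Mg)) => // z zst; apply: bg; apply: sub zst.
have Ifdg : itg `[s, t] (fun z => f z * dg z).
  by apply: (itg_bmul (c := Mf)) => // z zst; apply: bf; apply: sub zst.
(* The increment of the product is split as g s (f t - f s) + f t (g t - g s), so that each
   derivative gets multiplied by an oscillation of the other function. *)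
have -> : D s t = \int[mu]_(z in `[s, t])
    ((g s * df z - g z * df z) + (f t * dg z - f z * dg z)).
  rewrite RintegralD//; [|by apply: itgB => //; exact: itgZ..].
  rewrite !RintegralB//; [|exact: itgZ..].
  rewrite !RintegralZl// -Ef// -Eg// /D RintegralD//; ring.
have I2 : itg `[s, t] (fun z =>
    (g s * df z - g z * df z) + (f t * dg z - f z * dg z)).
  by apply: itgD => //; apply: itgB => //; exact: itgZ.
apply: le_trans (le_normr_Rintegral _ I2) _ => //.
set F := \int[mu]_(z in `[s, t]) `|df z|; set G := \int[mu]_(z in `[s, t]) `|dg z|.
have Inf := itg_norm mB Idf; have Ing := itg_norm mB Idg.
(* The oscillations are at most [G] and [F]. The bound integrates to 2 F G <= F^2 + G^2, and
   Cauchy-Schwarz on [s, t] yields (t - s) [m s t]. *)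
apply: (@le_trans _ _ (\int[mu]_(z in `[s, t]) (G * `|df z| + F * `|dg z|))).
  apply: le_Rintegral => //; [exact: itg_norm|by apply: itgD => //; exact: itgZ|].
  move=> z; rewrite /= in_itv/= => /andP[sz zt].
  apply: le_trans (ler_normD _ _) _; rewrite -!mulrBl !normrM.
  by apply: lerD; apply: ler_wpM2r => //; apply: ac2_osc; eassumption || lra.
rewrite RintegralD//; [|exact: itgZ..]; rewrite !RintegralZl// -/F -/G.
rewrite /m RintegralD//; [|exact: sfs.2|exact: sgs.2].
have HF := cauchy_schwarz_itv st sfs; have HG := cauchy_schwarz_itv st sgs.
rewrite -/F -/G in HF HG; rewrite mulrDr; have := sqr_ge0 (F - G); nra.
Qed.

Lemma ac2_lin a b f g df dg c d : ac2 a b f df -> ac2 a b g dg ->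
  ac2 a b (fun x => c * f x + d * g x) (fun x => c * df x + d * dg x).
Proof.
move=> [mf sf Ef] [mg sg Eg]; split.
- by apply: measurable_funD; apply: measurable_funM.
- exact: sqi_lin.
- move=> x y ax xy yb.
  have sub : (`[x, y] `<=` `[a, b])%classic by exact: itv_sub.
  have Idf : itg `[x, y] df by apply: itg_sub (sqi_itg sf).
  have Idg : itg `[x, y] dg by apply: itg_sub (sqi_itg sg).
  rewrite RintegralD//; [|exact: itgZ..].
  by rewrite !RintegralZl// -Ef// -Eg//; ring.
Qed.

(** The bridge from classical calculus: the explicit profiles and their quotients enter the weak
    setting through it. *)
Lemma ac2_C1 a b f g : (forall x, a <= x <= b -> is_derive x 1 f (g x)) ->
  (forall x, a <= x <= b -> {for x, continuous g}) -> ac2 a b f g.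
Proof.
move=> df cg.
have cf x : a <= x <= b -> {for x, continuous f}.
  by move=> xab; apply/differentiable_continuous/derivable1_diffP; case: (df x xab).
have wc (h : R -> R) : (forall x, a <= x <= b -> {for x, continuous h}) ->
    {within `[a, b], continuous h}.
  move=> ch; apply: continuous_in_subspaceT => x /set_mem xab.
  by apply: ch; move: xab; rewrite /= in_itv.
split.
- by apply: subspace_continuous_measurable_fun => //; exact: wc.
- split; first by apply: subspace_continuous_measurable_fun => //; exact: wc.
  apply: continuous_compact_integrable; first exact: segment_compact.
  apply: wc => x xab; have C := cg x xab.
  rewrite (_ : (fun z => g z ^+ 2) = (fun z => g z * g z)); first exact: continuousM.
  by apply/funext => z; rewrite expr2.
- move=> x y ax xy yb; have [->|xny] := eqVneq x y.
    by rewrite set_itv1 Rintegral_set1 subrr.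
  have xy' : x < y by rewrite lt_neqAle xny.
  have in_ z : x <= z <= y -> a <= z <= b.
    by move=> /andP[xz zy]; rewrite (le_trans ax xz) (le_trans zy yb).
  rewrite /Rintegral (@continuous_FTC2 _ g f)//.
  + apply: continuous_in_subspaceT => z /set_mem zxy.
    by apply: cg; apply: in_; move: zxy; rewrite /= in_itv.
  + split.
    * by move=> z; rewrite in_itv/= => /andP[xz zy]; case: (df z _) => //; apply: in_; rewrite !ltW.
    * by apply: cvg_at_right_filter; apply: cf; apply: in_; rewrite lexx.
    * by apply: cvg_at_left_filter; apply: cf; apply: in_; rewrite lexx andbT.
  + move=> z; rewrite in_itv/= => /andP[xz zy]; rewrite derive1E.
    by have [] := df z _; first by apply: in_; rewrite !ltW.
Qed.

End AbsolutelyContinuous.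

(** * The Sobolev space of the half line *)

Section HalfLine.
Variable R : realType.
Local Notation mu := (@lebesgue_measure R).
Local Notation msb A := (@measurable _ (measurableTypeR R) A).
Local Notation HL := (@halfline R).
Implicit Types (f g df dg : R -> R) (a b x y : R).

Lemma halfline_measurable : msb HL.
Proof. exact: measurable_itv. Qed.
Let mHL := halfline_measurable.

Lemma halflineP x : HL x <-> 0 <= x.
Proof. by rewrite /halfline /= in_itv/= andbT. Qed.

Lemma itv_halfline a b : 0 <= a -> (`[a, b] `<=` HL)%classic.
Proof.
by move=> a0 x /=; rewrite in_itv/= => /andP[ax _]; apply/halflineP; exact: le_trans ax.
Qed.

Lemma hintD f g : itg HL f -> itg HL g -> hint (fun x => f x + g x) = hint f + hint g.
Proof. exact: RintegralD. Qed.

Lemma hintZ f (c : R) : itg HL f -> hint (fun x => c * f x) = c * hint f.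
Proof. exact: RintegralZl. Qed.

Lemma eq_hint f g : (forall x, 0 <= x -> f x = g x) -> hint f = hint g.
Proof. by move=> fg; apply: eq_Rintegral => x /set_mem /halflineP; exact: fg. Qed.

Lemma hint_ge0 f : (forall x, 0 <= x -> 0 <= f x) -> 0 <= hint f.
Proof. by move=> f0; apply: Rintegral_ge0 => x /halflineP; exact: f0. Qed.

Lemma le_hint f g : itg HL f -> itg HL g -> (forall x, 0 <= x -> f x <= g x) -> hint f <= hint g.
Proof. by move=> If Ig fg; apply: le_Rintegral => // x /halflineP; exact: fg. Qed.

Lemma L2_sqi f : L2 f <-> sqi HL f.
Proof.
have E : (\int[mu]_(x in HL) `|(EFin \o (fun x => f x ^+ 2)%R) x| =
          \int[mu]_(x in HL) (f x ^+ 2)%:E)%E.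
  by apply: eq_integral => x _ /=; rewrite ger0_norm// sqr_ge0.
split => -[mf If]; split => //.
  apply/integrableP; split; last by rewrite E.
  by apply/measurable_EFinP; exact: measurable_funX.
by move/integrableP : If => [_]; rewrite E.
Qed.

Lemma H1_sqi f df : H1 f df -> sqi HL f /\ sqi HL df.
Proof. by move=> [/L2_sqi ? [/L2_sqi ? _]]. Qed.

Lemma H1_ac2 f df b : H1 f df -> ac2 0 b f df.
Proof.
move=> [/L2_sqi sf [/L2_sqi sdf E]].
have sub : (`[0%R, b] `<=` HL)%classic by exact: itv_halfline.
split.
- by apply: measurable_funS sf.1.
- by apply: sqi_sub sdf.
- move=> x y x0 xy yb; have y0 := le_trans x0 xy.
  have [Iy ->] := E y y0; have [_ ->] := E x x0.
  have := Rint_split x0 xy Iy; rewrite /Rintegral => ->; ring.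
Qed.

Lemma ac2_H1 f df : sqi HL f -> sqi HL df -> (forall b, ac2 0 b f df) -> H1 f df.
Proof.
move=> sf sdf H; split; [exact/L2_sqi|split; first exact/L2_sqi].
move=> x x0; have [_ sx E] := H x; split; first exact: sqi_itg sx.
have := E 0 x (lexx _) x0 (lexx _); rewrite /Rintegral => <-; ring.
Qed.

Lemma H1_lin f g df dg c d : H1 f df -> H1 g dg ->
  H1 (fun x => c * f x + d * g x) (fun x => c * df x + d * dg x).
Proof.
move=> Hf Hg; have [sf sdf] := H1_sqi Hf; have [sg sdg] := H1_sqi Hg.
apply: ac2_H1; [exact: sqi_lin..|move=> b].
by apply: ac2_lin; exact: H1_ac2.
Qed.

(** Dominated convergence with |f| as majorant. Every boundary term below is then a limit along a
    sequence of compact intervals. *)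
Lemma Rint_exhaust (D : set R) (A : nat -> set R) f : msb D -> (forall n, msb (A n)) ->
  (forall n, A n `<=` D) -> (forall x, D x -> \forall n \near \oo, A n x) -> itg D f ->
  \int[mu]_(x in A n) f x @[n --> \oo] --> \int[mu]_(x in D) f x.
Proof.
move=> mD mA AD ex If.
have -> : (fun n => \int[mu]_(x in A n) f x) = (fun n => \int[mu]_(x in D) (f \_ (A n)) x).
  apply/funext => n; have {1}-> : A n = D `&` A n.
    by apply/seteqP; split => x; [move=> Ax; split => //; exact: (AD n)|case].
  by rewrite Rintegral_mkcondr.
apply: fine_cvg; rewrite fineK; last exact: (integrable_fin_num mD If).
apply: (@dominated_cvg _ _ _ mu D mD (fun n x => ((f \_ (A n)) x)%:E) (EFin \o f)
  (EFin \o (fun x => `|f x|))) => //.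
- move=> n; apply/measurable_EFinP.
  have -> : f \_ (A n) = (fun x => f x * \1_(A n) x).
    apply/funext => x; rewrite patchE indicE.
    by case: ifP => xA; rewrite ?mulr1 ?mulr0.
  apply: measurable_funM; first exact: itg_measurable.
  exact: measurable_indic.
- move=> x Dx; apply: cvg_near_cst; apply: filterS (ex x Dx) => n Anx.
  by rewrite patchE mem_set.
- exact: itg_norm.
- move=> n x _; rewrite /= lee_fin patchE; case: ifP => // _.
  by rewrite normr0.
Qed.

Lemma Rint_0n_cvg f : itg HL f ->
  \int[mu]_(x in `[0, n.+1%:R]) f x @[n --> \oo] --> hint f.
Proof.
move=> If; apply: Rint_exhaust => //; first by move=> n; exact: itv_halfline.
move=> x /halflineP x0; near=> n; rewrite /= in_itv/= x0/=.
apply: (@le_trans _ _ n%:R); last by rewrite ler_nat.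
by near: n; exact: nbhs_infty_ger.
Unshelve. all: by end_near. Qed.

(** These intervals stay away from the vertex, where the logarithmic derivative of phi' is
    singular. *)
Lemma Rint_Vn_cvg f : itg HL f ->
  \int[mu]_(x in `[n.+1%:R^-1, n.+1%:R]) f x @[n --> \oo] --> hint f.
Proof.
move=> If; pose D : set R := `]0, +oo[%classic.
have mD : msb D by exact: measurable_itv.
have ID : itg D f.
  by apply: itg_sub If => // x; rewrite /D /= in_itv/= => /andP[/ltW ? _]; exact/halflineP.
have -> : hint f = \int[mu]_(x in D) f x.
  by rewrite /D Rintegral_itv_obnd_cbnd.
apply: Rint_exhaust => // [n x|x] /=.
  rewrite /D /= !in_itv/= => /andP[nx _]; rewrite andbT.
  by apply: lt_le_trans nx; rewrite invr_gt0.
rewrite /D /= in_itv/= andbT => x0; near=> n.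
have nx : x^-1 <= n.+1%:R.
  apply: (@le_trans _ _ n%:R); last by rewrite ler_nat.
  by near: n; exact: nbhs_infty_ger.
rewrite /= in_itv/=; apply/andP; split.
  by rewrite -[leRHS]invrK lef_pV2// posrE// invr_gt0.
apply: (@le_trans _ _ n%:R); last by rewrite ler_nat.
by near: n; exact: nbhs_infty_ger.
Unshelve. all: by end_near. Qed.

Lemma invn_le (n : nat) : n.+1%:R^-1 <= n.+1%:R :> R.
Proof. by apply: (@le_trans _ _ 1); [rewrite invf_le1// ler1n|rewrite ler1n]. Qed.

Lemma Rint_0V_cvg0 f : itg HL f ->
  \int[mu]_(x in `[0, n.+1%:R^-1]) f x @[n --> \oo] --> (0 : R).
Proof.
move=> If; suff : \int[mu]_(x in `[0, n.+1%:R^-1]) f x @[n --> \oo] --> hint f - hint f.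
  by rewrite subrr.
have -> : (fun n : nat => \int[mu]_(x in `[0, n.+1%:R^-1]) f x) =
    (fun n : nat => \int[mu]_(x in `[0, n.+1%:R]) f x -
      \int[mu]_(x in `[n.+1%:R^-1, n.+1%:R]) f x).
  apply/funext => n; rewrite (@Rint_split _ 0 n.+1%:R^-1 n.+1%:R); first by ring.
  - by rewrite invr_ge0.
  - exact: invn_le.
  - by apply: itg_sub If => //; exact: itv_halfline.
by apply: cvgB; [exact: Rint_0n_cvg|exact: Rint_Vn_cvg].
Qed.

Lemma Rint_tail_cvg0 f : itg HL f ->
  \int[mu]_(x in `[n.+1%:R, n.+1%:R + 1]) f x @[n --> \oo] --> (0 : R).
Proof.
move=> If.
suff : \int[mu]_(x in `[n.+1%:R, n.+1%:R + 1]) f x @[n --> \oo] --> hint f - hint f.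
  by rewrite subrr.
have -> : (fun n : nat => \int[mu]_(x in `[n.+1%:R, n.+1%:R + 1]) f x) =
    (fun n : nat => \int[mu]_(x in `[0, n.+2%:R]) f x - \int[mu]_(x in `[0, n.+1%:R]) f x).
  apply/funext => n; rewrite (@Rint_split _ 0 n.+1%:R n.+2%:R)//.
  - by rewrite -[n.+2%:R]natr1; ring.
  - by rewrite ler_nat.
  - by apply: itg_sub If => //; exact: itv_halfline.
apply: cvgB; last exact: Rint_0n_cvg.
have := Rint_0n_cvg If; rewrite -(cvg_shiftS (fun n : nat => \int[mu]_(x in `[0, n.+1%:R]) f x)).
exact.
Qed.

Lemma itg_le_hint f a b : 0 <= a -> (forall x, 0 <= x -> 0 <= f x) -> itg HL f ->
  \int[mu]_(x in `[a, b]) f x <= hint f.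
Proof.
move=> a0 f0 If; rewrite /hint -[X in _ <= X]/(Rintegral mu HL f).
have sub : (`[a, b] `<=` HL)%classic by exact: itv_halfline.
rewrite /Rintegral fine_le//.
- by apply: integrable_fin_num => //; exact: itg_sub If.
- exact: integrable_fin_num.
apply: ge0_subset_integral => //.
  by apply/measurable_EFinP; exact: itg_measurable If.
by move=> x /halflineP /f0; rewrite lee_fin.
Qed.

(* Average [f x ^+ 2 <= 2 * f y ^+ 2 + 2 * (f x - f y) ^+ 2] over [y] in [[x, x + 1]]. *)
Lemma H1_sqr_le f df x : H1 f df -> 0 <= x ->
  f x ^+ 2 <= 2 * \int[mu]_(t in `[x, x + 1]) (f t ^+ 2 + df t ^+ 2).
Proof.
move=> Hf x0; have [sf sdf] := H1_sqi Hf.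
have xx1 : x <= x + 1 by lra.
have sub : (`[x, x + 1] `<=` HL)%classic by exact: itv_halfline.
have sfx : sqi `[x, x + 1] f by exact: sqi_sub sf.
have sdx : sqi `[x, x + 1] df by exact: sqi_sub sdf.
set G := \int[mu]_(t in `[x, x + 1]) (df t ^+ 2).
rewrite RintegralD//; [|exact: sfx.2|exact: sdx.2]; rewrite -/G.
have -> : f x ^+ 2 = \int[mu]_(t in `[x, x + 1]) (f x ^+ 2).
  by rewrite Rint_cst//; ring.
have -> : 2 * (\int[mu]_(t in `[x, x + 1]) f t ^+ 2 + G) =
    \int[mu]_(t in `[x, x + 1]) (2 * f t ^+ 2 + 2 * G).
  rewrite RintegralD//; [|by apply: itgZ => //; exact: sfx.2|exact: itg_cst].
  rewrite RintegralZl//; last exact: sfx.2.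
  by rewrite Rint_cst//; ring.
apply: le_Rintegral => //; first exact: itg_cst.
  by apply: itgD => //; [apply: itgZ => //; exact: sfx.2|exact: itg_cst].
move=> y; rewrite /= in_itv/= => /andP[xy yx].
have A := ac2_sub x0 (lexx (x + 1)) (H1_ac2 (x + 1) Hf).
have O := ac2_osc A xy yx (lexx x) xx1.
have C := cauchy_schwarz_itv xx1 sdx; rewrite -/G in C.
have : (f x - f y) ^+ 2 <= G.
  apply: le_trans (_ : _ <= (\int[mu]_(t in `[x, x + 1]) `|df t|) ^+ 2) _.
    by rewrite -(real_normK (num_real _)); apply: lerXn2r; rewrite ?nnegrE// (le_trans _ O).
  by move: C; rewrite (addrC x) addrK mul1r.
have := sqr_ge0 (f x - 2 * f y); nra.
Qed.

Lemma H1_bounded f df : H1 f df -> exists M, 0 <= M /\ forall x, 0 <= x -> `|f x| <= M.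
Proof.
move=> Hf; have [[mf If] [mdf Idf]] := H1_sqi Hf.
have I2 := itgD mHL If Idf.
set G := hint (fun x => f x ^+ 2 + df x ^+ 2).
have G0 : 0 <= G by apply: Rintegral_ge0 => x _; rewrite addr_ge0// sqr_ge0.
exists (1 + 2 * G); split => [|x x0]; first by lra.
have := H1_sqr_le Hf x0.
have : \int[mu]_(t in `[x, x + 1]) (f t ^+ 2 + df t ^+ 2) <= G.
  by apply: itg_le_hint => // t _; rewrite addr_ge0// sqr_ge0.
rewrite -(real_normK (num_real (f x))); have := normr_ge0 (f x).
set u := `|f x|; have := sqr_ge0 (u - 1); nra.
Qed.

Lemma H1_decay f df : H1 f df -> f n.+1%:R ^+ 2 @[n --> \oo] --> (0 : R).
Proof.
move=> Hf; have [[mf If] [mdf Idf]] := H1_sqi Hf.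
have I2 := itgD mHL If Idf.
have C : 2 * \int[mu]_(t in `[n.+1%:R, n.+1%:R + 1]) (f t ^+ 2 + df t ^+ 2)
    @[n --> \oo] --> (0 : R).
  by rewrite -(mulr0 2); apply: cvgMr; exact: Rint_tail_cvg0.
apply: (squeeze_cvgr _ (cvg_cst 0) C); apply: nearW => n.
by rewrite sqr_ge0/=; exact: H1_sqr_le.
Qed.

Lemma H1_cvg0 f df : H1 f df -> f n.+1%:R @[n --> \oo] --> (0 : R).
Proof.
move=> Hf; apply/cvgr0Pnorm_lt => e e0.
have /cvgr0Pnorm_lt/(_ (e ^+ 2)) := H1_decay Hf; rewrite exprn_gt0// => /(_ isT).
apply: filterS => n; rewrite normrX => H.
by rewrite -(@ltr_pXn2r _ 2) ?nnegrE// ltW.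
Qed.

(** Cauchy-Schwarz from the vertex gives f(e)^2 <= e int_0^e f'^2, and the last integral tends to 0.
    This gains exactly the little o needed against a weight of size 1 / e. *)
Lemma H1_vertex f df : H1 f df -> f 0 = 0 ->
  n.+1%:R * f n.+1%:R^-1 ^+ 2 @[n --> \oo] --> (0 : R).
Proof.
move=> Hf f0; have [_ sdf] := H1_sqi Hf.
apply: (squeeze_cvgr _ (cvg_cst 0) (Rint_0V_cvg0 sdf.2)); apply: nearW => n.
set e := n.+1%:R^-1; have e0 : 0 < e by rewrite invr_gt0.
have -> : n.+1%:R = e^-1 by rewrite invrK.
rewrite mulr_ge0 ?sqr_ge0 ?invr_ge0 ?(ltW e0)//= ler_pdivrMl//.
have A := H1_ac2 e Hf; have [_ sde _] := A.
apply: le_trans (_ : _ <= (\int[mu]_(t in `[0, e]) `|df t|) ^+ 2) _; last first.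
  by have := cauchy_schwarz_itv (ltW e0) sde; rewrite subr0.
have := ac2_osc A (lexx 0) (ltW e0) (ltW e0) (lexx e); rewrite f0 subr0 => H.
by rewrite -(real_normK (num_real (f e))); apply: lerXn2r; rewrite ?nnegrE// (le_trans _ H).
Qed.

End HalfLine.

(** * Differentiation rules in pointwise form *)

Section PointwiseDerivatives.
Variable R : realType.
Implicit Types (f g : R -> R) (x : R).

Lemma is_derive_addf f g x df dg : is_derive x 1 f df -> is_derive x 1 g dg ->
  is_derive x 1 (fun y => f y + g y) (df + dg).
Proof. by move=> Hf Hg; have := is_deriveD Hf Hg. Qed.

Lemma is_derive_mulf f g x df dg : is_derive x 1 f df -> is_derive x 1 g dg ->
  is_derive x 1 (fun y => f y * g y) (df * g x + f x * dg).
Proof.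
move=> Hf Hg; have := is_deriveM Hf Hg.
by move/is_derive_eq; apply; rewrite addrC [X in X + _]mulrC.
Qed.

Lemma is_derive_cstf (c : R) x : is_derive x 1 (fun=> c) 0.
Proof. exact: is_derive_cst. Qed.

Lemma is_derive_idf x : is_derive x 1 (fun y : R => y) 1.
Proof. exact: is_derive_id. Qed.

Lemma is_derive_scalef c f x df : is_derive x 1 f df -> is_derive x 1 (fun y => c * f y) (c * df).
Proof.
move=> Hf; have := is_derive_mulf (is_derive_cstf c x) Hf.
by move/is_derive_eq; apply; rewrite mul0r add0r.
Qed.

Lemma is_derive_oppf f x df : is_derive x 1 f df -> is_derive x 1 (fun y => - f y) (- df).
Proof. by move=> Hf; have := is_deriveN Hf. Qed.

Lemma is_derive_subf f g x df dg : is_derive x 1 f df -> is_derive x 1 g dg ->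
  is_derive x 1 (fun y => f y - g y) (df - dg).
Proof. by move=> Hf Hg; have := is_deriveB Hf Hg. Qed.

Lemma is_derive_sqrf f x df : is_derive x 1 f df ->
  is_derive x 1 (fun y => f y ^+ 2) (2 * f x * df).
Proof.
move=> Hf; have := is_derive_mulf Hf Hf => /is_derive_eq.
rewrite (_ : (fun y => f y * f y) = (fun y => f y ^+ 2)).
  by apply; ring.
by apply/funext => y; rewrite expr2.
Qed.

Lemma is_derive_invf f x df : is_derive x 1 f df -> f x != 0 ->
  is_derive x 1 (fun y => (f y)^-1) (- df / f x ^+ 2).
Proof.
move=> Hf fx; have := is_deriveV fx Hf; move/is_derive_eq; apply.
by rewrite /GRing.scale/= mulNr mulrC mulNr.
Qed.

Lemma is_derive_continuous f x df : is_derive x 1 f df -> {for x, continuous f}.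
Proof. by move=> [df_ _]; apply/differentiable_continuous/derivable1_diffP. Qed.

Lemma is_derive_derive1 f g : (forall x, is_derive x 1 f (g x)) -> derive1 f = g.
Proof. by move=> H; apply/funext => x; rewrite derive1E; case: (H x). Qed.

End PointwiseDerivatives.

(** * The soliton profile *)

Section Soliton.
Variables (R : realType) (p : R).
Hypothesis p_gt0 : 0 < p.
Local Notation mu := (@lebesgue_measure R).
Local Notation HL := (@halfline R).
Local Notation phi := (@phi R p).
Implicit Types (x : R).

(** All the calculus of the profile runs through T = tanh (p x): phi' = - T phi, T' = p (1 - T^2)
    and phi^(2p) = 1 - T^2, so the potentials are polynomials in T and the differential equations
    reduce to ring identities. *)
Definition tanhp (p x : R) : R :=
  (expR (p * x) - expR (- (p * x))) / (expR (p * x) + expR (- (p * x))).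
Local Notation T := (tanhp p).

Let S x : R := 2 / (expR (p * x) + expR (- (p * x))).

Let den_gt0 x : 0 < expR (p * x) + expR (- (p * x)).
Proof. by rewrite addr_gt0// expR_gt0. Qed.

Let S_gt0 x : 0 < S x.
Proof. by rewrite divr_gt0. Qed.

Lemma sqr_sechp x : S x ^+ 2 = 1 - T x ^+ 2.
Proof.
have := den_gt0 x; have := expRxMexpNx_1 (p * x); rewrite /S /tanhp.
set u := expR (p * x); set v := expR _ => uv uv0.
have : u + v != 0 by rewrite gt_eqF.
by move=> n0; field: uv; rewrite n0.
Qed.

Let dexp x : is_derive x 1 (fun y => expR (p * y)) (p * expR (p * x)).
Proof.
have H : is_derive x 1 (fun y => p * y) (p * 1) by apply: is_derive_scalef; exact: is_derive_idf.
have := is_derive1_comp (is_derive_expR (p * x)) H.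
by move/is_derive_eq; apply; rewrite mulr1 mulrC.
Qed.

Let dexpN x : is_derive x 1 (fun y => expR (- (p * y))) (- p * expR (- (p * x))).
Proof.
have H : is_derive x 1 (fun y => - (p * y)) (- (p * 1)).
  by apply: is_derive_oppf; apply: is_derive_scalef; exact: is_derive_idf.
have := @is_derive1_comp R expR (fun y => - (p * y)) x _ _ (is_derive_expR _) H.
by move/is_derive_eq; apply; rewrite mulr1 mulrC.
Qed.

Lemma is_derive_tanhp x : is_derive x 1 T (p * (1 - T x ^+ 2)).
Proof.
have n0 : expR (p * x) + expR (- (p * x)) != 0 by rewrite gt_eqF.
have := is_derive_mulf (is_derive_subf (dexp x) (dexpN x))
  (is_derive_invf (is_derive_addf (dexp x) (dexpN x)) n0).
move/is_derive_eq; apply; rewrite /tanhp.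
move: n0; set u := expR (p * x); set v := expR _ => n0.
by field.
Qed.

Lemma phi_gt0 x : 0 < phi x.
Proof. by rewrite powR_gt0// S_gt0. Qed.

Lemma is_derive_phi x : is_derive x 1 phi (- (T x * phi x)).
Proof.
have n0 : expR (p * x) + expR (- (p * x)) != 0 by rewrite gt_eqF.
have dS : is_derive x 1 S (- p * T x * S x).
  have := is_derive_scalef 2 (is_derive_invf (is_derive_addf (dexp x) (dexpN x)) n0).
  move/is_derive_eq; apply; rewrite /tanhp /S.
  move: n0; set u := expR (p * x); set v := expR _ => n0.
  by field.
have := is_derive1_comp (is_derive1_powR p^-1 (S_gt0 x)) dS.
move/is_derive_eq; apply; rewrite -/(S x).
have E : phi x = S x `^ (p^-1 - 1) * S x.
  rewrite -[X in _ * X]powRr1 ?ltW// -powRD ?subrK//.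
  by apply/implyP => _; rewrite gt_eqF.
rewrite E; field; by rewrite gt_eqF.
Qed.

(** The base is squared because the nonlinear term of [Lambda] is a power of the squared modulus. *)
Lemma powR_phi x : powR (phi x ^+ 2) p = 1 - T x ^+ 2.
Proof.
have f0 := ltW (phi_gt0 x).
rewrite -powR_mulrn// -powRrM /Defs.phi -/(S x) -powRrM mulrCA mulVf ?gt_eqF// mulr1.
by rewrite powR_mulrn ?ltW// sqr_sechp.
Qed.

Lemma tanhp0 : T 0 = 0.
Proof. by rewrite /tanhp mulr0 oppr0 subrr mul0r. Qed.

Lemma tanhp_sqr_le1 x : T x ^+ 2 <= 1.
Proof. by have := sqr_ge0 (S x); rewrite sqr_sechp; lra. Qed.

Lemma tanhp_norm_le1 x : `|T x| <= 1.
Proof.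
have := tanhp_sqr_le1 x; rewrite -(real_normK (num_real (T x))).
by rewrite expr_le1.
Qed.

(** The useful form is 1 / T <= 1 + 1 / (p x), which bounds phi'' / phi' both near the vertex and at
    infinity. *)
Lemma tanhp_lower x : 0 <= x -> p * x / (1 + p * x) <= T x.
Proof.
move=> x0; have px0 : 0 <= p * x by rewrite mulr_ge0// ltW.
have := den_gt0 x; have := expRxMexpNx_1 (p * x); rewrite /tanhp.
have := expR_ge1Dx (p * x); have := expR_gt0 (- (p * x)).
set y := p * x in px0 *; set u := expR y; set v := expR (- y) => v0 yu uv uv0.
rewrite ler_pdivrMr; last by lra.
rewrite mulrAC ler_pdivlMr//.
(* After multiplication by u, the relation u v = 1 turns the claim into u^2 >= 1 + 2 y, a
   consequence of u >= 1 + y. *)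
have : 0 <= u * (u - v - y * (u + v) + y * (u - v)) by nra.
by rewrite pmulr_rge0 ?expR_gt0//; lra.
Qed.

Lemma tanhp_gt0 x : 0 < x -> 0 < T x.
Proof.
move=> x0; apply: lt_le_trans (tanhp_lower (ltW x0)).
have px0 : 0 < p * x by rewrite mulr_gt0.
by rewrite divr_gt0//; lra.
Qed.

Lemma phi_le_expR : exists2 C : R, 0 <= C & forall x, phi x <= C * expR (- x).
Proof.
exists (powR 2 p^-1); first exact: powR_ge0.
move=> x; have -> : expR (- x) = powR (expR (- (p * x))) p^-1.
  by rewrite -expRM; congr expR; field; rewrite gt_eqF.
rewrite -powRM ?expR_ge0//; apply: ge0_ler_powR.
- by rewrite invr_ge0 ltW.
- by rewrite nnegrE ltW// S_gt0.
- by rewrite nnegrE mulr_ge0// expR_ge0.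
rewrite -/(S x) /S ler_pM2l// [leRHS]expRN lef_pV2 ?posrE ?expR_gt0//.
by rewrite lerDl expR_ge0.
Qed.

End Soliton.

(** * Sobolev regularity and differential equations of phi, phi' and theta *)

Section SolitonH1.
Variables (R : realType) (p : R).
Hypothesis p_gt0 : 0 < p.
Local Notation mu := (@lebesgue_measure R).
Local Notation HL := (@halfline R).
Local Notation phi := (@phi R p).
Local Notation T := (tanhp p).
Implicit Types (f g : R -> R) (x : R).

Let mHL := @halfline_measurable R.

Lemma itg_expRN : itg HL (fun x => expR (- x)).
Proof.
have dE x : is_derive x 1 (fun y : R => - expR (- y)) (expR (- x)).
  have H : is_derive x 1 (fun y : R => - y) (- 1) by apply: is_derive_oppf; exact: is_derive_idf.
  have := is_derive_oppf (@is_derive1_comp R expR (fun y => - y) x _ _ (is_derive_expR _) H).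
  by move/is_derive_eq; apply; rewrite mulrN1 opprK.
have cE : continuous (fun x : R => expR (- x)).
  by move=> x; apply: continuous_comp; [exact: opp_continuous|exact: continuous_expR].
apply/integrableP; split.
  apply/measurable_EFinP; apply: measurable_funTS; exact: continuous_measurable_fun.
have -> : (\int[mu]_(x in HL) `|(EFin \o (fun x : R => expR (- x))) x| =
          \int[mu]_(x in HL) (expR (- x))%:E)%E.
  by apply: eq_integral => x _ /=; rewrite ger0_norm// expR_ge0.
rewrite /halfline (@ge0_continuous_FTC2y R (fun x => expR (- x)) (fun x => - expR (- x)) 0 0).
- by rewrite -EFinB ltry.
- by move=> x _; exact: expR_ge0.
- exact: continuous_subspaceT.
- by rewrite -[X in _ --> X]oppr0; apply: cvgN; exact: cvgr_expR.
- by move=> x _; case: (dE x).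
- by apply: cvg_at_right_filter; exact: is_derive_continuous (dE 0).
- by move=> x _; rewrite (is_derive_derive1 dE).
Qed.

Lemma sqi_exp_decay f C : continuous f ->
  (forall x, 0 <= x -> `|f x| <= C * expR (- (x / 2))) -> sqi HL f.
Proof.
move=> cf fC.
have mf : measurable_fun HL f by apply: measurable_funTS; exact: continuous_measurable_fun.
split => //; apply: (itg_dom mHL _ (itgZ (C ^+ 2) mHL itg_expRN)).
  exact: measurable_funX.
move=> x /halflineP /fC H; rewrite ger0_norm ?sqr_ge0// -(real_normK (num_real (f x))).
have -> : expR (- x) = expR (- (x / 2)) ^+ 2 by rewrite expr2 -expRD; congr expR; field.
rewrite -exprMn; apply: lerXn2r; rewrite ?nnegrE//.
exact: le_trans H.
Qed.

(** Half of the decay exp (- x) pays for the factor 1 + x, through 1 + x <= 2 exp (x / 2). The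
    factor is there for theta, which contains x phi'. *)
Lemma phi_lin_le : exists2 C, 0 <= C &
  forall x, 0 <= x -> (1 + x) * phi x <= C * expR (- (x / 2)).
Proof.
have [C C0 phiC] := phi_le_expR p_gt0; exists (2 * C) => [|x x0]; first by rewrite mulr_ge0.
have := phiC x; have := expR_ge1Dx (x / 2); have := expRxMexpNx_1 (x / 2).
have -> : expR (- x) = expR (- (x / 2)) ^+ 2 by rewrite expr2 -expRD; congr expR; field.
have := expR_gt0 (- (x / 2)); set u := expR (x / 2); set v := expR _ => v0 uv xu ph.
apply: (@le_trans _ _ ((2 * u) * (C * v ^+ 2))).
  apply: ler_pM => //; [lra|by rewrite ltW// phi_gt0|lra].
rewrite (_ : (2 * u) * (C * v ^+ 2) = 2 * C * v * (u * v)); last by ring.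
by rewrite uv mulr1.
Qed.

Lemma phi_smooth_H1 f g K : 0 <= K -> (forall x, is_derive x 1 f (g x)) -> continuous g ->
  (forall x, 0 <= x -> `|f x| <= K * ((1 + x) * phi x)) ->
  (forall x, 0 <= x -> `|g x| <= K * ((1 + x) * phi x)) -> H1 f g.
Proof.
move=> K0 df cg fK gK; have [C C0 phiC] := phi_lin_le.
have B x : 0 <= x -> K * ((1 + x) * phi x) <= K * C * expR (- (x / 2)).
  by move=> x0; rewrite -mulrA ler_wpM2l// phiC.
have cf : continuous f by move=> x; exact: is_derive_continuous (df x).
apply: ac2_H1.
- by apply: (sqi_exp_decay (C := K * C)) => // x x0; apply: le_trans (B x x0); exact: fK.
- by apply: (sqi_exp_decay (C := K * C)) => // x x0; apply: le_trans (B x x0); exact: gK.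
- by move=> b; apply: ac2_C1 => // x _; exact: cg.
Qed.

Definition dphi x : R := - (T x * phi x).
(** Since 1 - T^2 = phi^(2p), [Wminus] and [Wplus] are 1 - (p + 1) phi^(2p) and 1 - (p + 1)(2 p + 1)
    phi^(2p), the potentials of the linearisation on imaginary and on real parts. *)
Definition Wminus x : R := 1 - (p + 1) * (1 - T x ^+ 2).
Definition Wplus x : R := 1 - (p + 1) * (2 * p + 1) * (1 - T x ^+ 2).
Definition d2phi x : R := Wminus x * phi x.
Definition theta x : R := phi x / (2 * p) + x * dphi x / 2.
Definition dtheta x : R := dphi x / (2 * p) + (dphi x + x * d2phi x) / 2.

Lemma is_derive_Wminus x : is_derive x 1 Wminus (2 * p * (p + 1) * T x * (1 - T x ^+ 2)).
Proof.
have := is_derive_subf (is_derive_cstf 1 x) (is_derive_scalef (p + 1)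
  (is_derive_subf (is_derive_cstf 1 x) (is_derive_sqrf (is_derive_tanhp p x)))).
by move/is_derive_eq; apply; ring.
Qed.

Lemma is_derive_phi_dphi x : is_derive x 1 phi (dphi x).
Proof. exact: is_derive_phi. Qed.

Lemma is_derive_dphi x : is_derive x 1 dphi (d2phi x).
Proof.
have := is_derive_oppf (is_derive_mulf (is_derive_tanhp p x) (is_derive_phi p_gt0 x)).
by move/is_derive_eq; apply; rewrite /d2phi /Wminus; ring.
Qed.

Lemma is_derive_d2phi x : is_derive x 1 d2phi (Wplus x * dphi x).
Proof.
have := is_derive_mulf (is_derive_Wminus x) (is_derive_phi p_gt0 x).
by move/is_derive_eq; apply; rewrite /Wplus /dphi /Wminus; ring.
Qed.

Lemma is_derive_theta x : is_derive x 1 theta (dtheta x).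
Proof.
have -> : theta = fun y => (2 * p)^-1 * phi y + 2^-1 * (y * dphi y).
  by apply/funext => y; rewrite /theta; ring.
have := is_derive_addf (is_derive_scalef (2 * p)^-1 (is_derive_phi_dphi x))
  (is_derive_scalef 2^-1 (is_derive_mulf (is_derive_idf x) (is_derive_dphi x))).
by move/is_derive_eq; apply; rewrite /dtheta; ring.
Qed.

(* [theta] is the derivative in [omega], at [1], of the soliton of frequency [omega]. *)
Lemma is_derive_dtheta x : is_derive x 1 dtheta (Wplus x * theta x + phi x).
Proof.
have -> : dtheta = fun y => ((2 * p)^-1 + 2^-1) * dphi y + 2^-1 * (y * d2phi y).
  by apply/funext => y; rewrite /dtheta; ring.
have := is_derive_addf (is_derive_scalef ((2 * p)^-1 + 2^-1) (is_derive_dphi x))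
  (is_derive_scalef 2^-1 (is_derive_mulf (is_derive_idf x) (is_derive_d2phi x))).
move/is_derive_eq; apply; rewrite /d2phi /theta /Wplus /Wminus /dphi; field.
by rewrite gt_eqF.
Qed.

Lemma continuous_Wplus : continuous Wplus.
Proof.
move=> x; have D := is_derive_subf (is_derive_cstf 1 x)
  (is_derive_scalef ((p + 1) * (2 * p + 1))
  (is_derive_subf (is_derive_cstf 1 x) (is_derive_sqrf (is_derive_tanhp p x)))).
exact: is_derive_continuous D.
Qed.

Lemma continuous_Wminus : continuous Wminus.
Proof. by move=> x; exact: is_derive_continuous (is_derive_Wminus x). Qed.

Lemma Wplus_norm_le x : `|Wplus x| <= 1 + (p + 1) * (2 * p + 1).
Proof.
have := tanhp_sqr_le1 p x; have := sqr_ge0 (T x); rewrite /Wplus => h0 h1.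
have k0 : 0 < (p + 1) * (2 * p + 1) by rewrite mulr_gt0 ?addr_gt0 ?mulr_gt0.
move: k0; set k := (p + 1) * (2 * p + 1) => k0.
have := mulr_ge0 (ltW k0) h0; have : 0 <= k * (1 - T x ^+ 2) by rewrite mulr_ge0//; lra.
by move=> *; rewrite ler_norml; apply/andP; split; lra.
Qed.

Lemma Wminus_norm_le x : `|Wminus x| <= p + 2.
Proof.
have := tanhp_sqr_le1 p x; have := sqr_ge0 (T x); rewrite /Wminus => h0 h1.
have p0 := p_gt0; have := mulr_ge0 (ltW p_gt0) h0; have : 0 <= p * (1 - T x ^+ 2) by rewrite mulr_ge0//; lra.
by move=> *; rewrite ler_norml; apply/andP; split; lra.
Qed.

Lemma dphi_norm_le x : `|dphi x| <= phi x.
Proof.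
rewrite normrN normrM (ger0_norm (ltW (phi_gt0 p x))).
by rewrite ler_piMl ?tanhp_norm_le1// ltW// phi_gt0.
Qed.

Lemma d2phi_norm_le x : `|d2phi x| <= (p + 2) * phi x.
Proof.
rewrite normrM (ger0_norm (ltW (phi_gt0 p x))).
by rewrite ler_wpM2r ?Wminus_norm_le// ltW// phi_gt0.
Qed.

Lemma H1_phi : H1 phi dphi.
Proof.
apply: (phi_smooth_H1 (K := 1)) => //.
- exact: is_derive_phi.
- by move=> x; exact: is_derive_continuous (is_derive_dphi x).
- move=> x x0; rewrite (ger0_norm (ltW (phi_gt0 p x))).
  by have := phi_gt0 p x; nra.
- move=> x x0; apply: le_trans (dphi_norm_le x) _.
  by have := phi_gt0 p x; nra.
Qed.

Lemma H1_dphi : H1 dphi d2phi.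
Proof.
have p0 := p_gt0; apply: (phi_smooth_H1 (K := p + 2)); first by lra.
- exact: is_derive_dphi.
- by move=> x; exact: is_derive_continuous (is_derive_d2phi x).
- move=> x x0; apply: le_trans (dphi_norm_le x) _.
  by rewrite mulrA ler_peMl ?(ltW (phi_gt0 p x))//; nra.
- move=> x x0; apply: le_trans (d2phi_norm_le x) _.
  by rewrite mulrA; apply: ler_wpM2r; rewrite ?(ltW (phi_gt0 p x))//; nra.
Qed.

Lemma theta_norm_le x : 0 <= x -> `|theta x| <= ((2 * p)^-1 + p + 2) * ((1 + x) * phi x).
Proof.
have p0 := p_gt0; have v0 : 0 < (2 * p)^-1 by rewrite invr_gt0; lra.
move=> x0; have := dphi_norm_le x; have f0 := phi_gt0 p x.
rewrite /theta; move: (2 * p)^-1 v0 => v v0 H.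
apply: le_trans (ler_normD _ _) _.
rewrite !normrM normfV !(ger0_norm (ltW f0)) (ger0_norm (ltW v0)) (ger0_norm x0).
rewrite (ger0_norm (ler0n _ 2)); move: H; set d := `|_| => H.
have := ler_wpM2l x0 H; have := mulr_ge0 x0 (ltW f0); nra.
Qed.

Lemma dtheta_norm_le x : 0 <= x -> `|dtheta x| <= ((2 * p)^-1 + p + 2) * ((1 + x) * phi x).
Proof.
have p0 := p_gt0; have v0 : 0 < (2 * p)^-1 by rewrite invr_gt0; lra.
move=> x0; have := d2phi_norm_le x; have := dphi_norm_le x; have f0 := phi_gt0 p x.
rewrite /dtheta; move: (2 * p)^-1 v0 => v v0 H H2.
apply: le_trans (ler_normD _ _) _.
rewrite !normrM normfV (ger0_norm (ltW v0)) (ger0_norm (ler0n _ 2)).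
have H3 := ler_normD (dphi x) (x * d2phi x); rewrite normrM (ger0_norm x0) in H3.
move: H H2 H3; set d := `|dphi x|; set d2 := `|d2phi x|; set d3 := `|_ + _| => H H2 H3.
have xf := mulr_ge0 x0 (ltW f0); have := ler_wpM2l x0 H2.
have pxf := mulr_ge0 (ltW p_gt0) xf; have pf := mulr_ge0 (ltW p_gt0) (ltW f0).
have vf := mulr_ge0 (ltW v0) (ltW f0); have vxf := mulr_ge0 (ltW v0) xf.
have := ler_wpM2l (ltW v0) H; nra.
Qed.

Lemma H1_theta : H1 theta dtheta.
Proof.
have p0 := p_gt0; have v0 : 0 < (2 * p)^-1 by rewrite invr_gt0; lra.
apply: (phi_smooth_H1 (K := (2 * p)^-1 + p + 2)); first by lra.
- exact: is_derive_theta.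
- by move=> x; exact: is_derive_continuous (is_derive_dtheta x).
- exact: theta_norm_le.
- exact: dtheta_norm_le.
Qed.

(** For the integration by parts against theta: at infinity v tends to 0 and theta' only has to stay
    bounded. *)
Lemma dtheta_bounded : exists2 B, 0 <= B & forall x, 0 <= x -> `|dtheta x| <= B.
Proof.
have p0 := p_gt0; have v0 : 0 < (2 * p)^-1 by rewrite invr_gt0; lra.
have [C C0 phiC] := phi_lin_le; exists (((2 * p)^-1 + p + 2) * C).
  by rewrite mulr_ge0//; lra.
move=> x x0; apply: le_trans (dtheta_norm_le x0) _; apply: ler_wpM2l; first by lra.
apply: le_trans (phiC _ x0) _; rewrite ler_piMr//.
by rewrite -expR0 ler_expR oppr_le0 divr_ge0.
Qed.

Lemma dphi0 : dphi 0 = 0.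
Proof. by rewrite /dphi tanhp0 mul0r oppr0. Qed.

Lemma dtheta0 : dtheta 0 = 0.
Proof. by rewrite /dtheta dphi0 !(mul0r, addr0). Qed.

Lemma theta0_gt0 : 0 < theta 0.
Proof. by rewrite /theta mul0r mul0r addr0 divr_gt0 ?phi_gt0// mulr_gt0. Qed.

Lemma dphi_lt0 x : 0 < x -> dphi x < 0.
Proof. by move=> x0; rewrite oppr_lt0 mulr_gt0 ?phi_gt0// tanhp_gt0. Qed.

End SolitonH1.

(** * The Darboux factorisation *)

Section Jacobi.
Variable R : realType.
Local Notation mu := (@lebesgue_measure R).
Local Notation HL := (@halfline R).
Local Notation msb A := (@measurable _ (measurableTypeR R) A).
Variables (psi dpsi W v dv : R -> R) (K C : R).
Implicit Types (a b x : R).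
Hypothesis Dpsi : forall x : R, is_derive x 1 psi (dpsi x).
Hypothesis Ddpsi : forall x : R, is_derive x 1 dpsi (W x * psi x).
Hypothesis cW : continuous W.
Hypothesis WK : forall x, `|W x| <= K.
Hypothesis psi_neq0 : forall x, 0 < x -> psi x != 0.
Hypothesis Hv : H1 v dv.
Let r (x : R) : R := dpsi x / psi x.
(** This and the next hypothesis dispose of the boundary terms r v^2: at infinity a bounded r
    suffices because v^2 tends to 0, while at the vertex r may blow up and the product itself is
    controlled, along the points 1 / (n + 1). *)
Hypothesis rC : forall x, 1 <= x -> `|r x| <= C.
Hypothesis r_vertex : r n.+1%:R^-1 * v n.+1%:R^-1 ^+ 2 @[n --> \oo] --> (0 : R).

Let mHL := @halfline_measurable R.
Let q (x : R) : R := dv x ^+ 2 + W x * v x ^+ 2.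

Let Dr x : 0 < x -> is_derive x 1 r (W x - r x * r x).
Proof.
move=> x0; have n0 := psi_neq0 x0.
have := is_derive_mulf (Ddpsi x) (is_derive_invf (Dpsi x) n0).
by move/is_derive_eq; apply; rewrite /r; field.
Qed.

Let itgq : itg HL q.
Proof.
have [sv sdv] := H1_sqi Hv; apply: itgD => //; first exact: sdv.2.
apply: (itg_bmul (c := K)) => //; last exact: sv.2.
by apply: measurable_funTS; exact: continuous_measurable_fun.
Qed.

Let acr a b : 0 < a -> ac2 a b r (fun x => W x - r x * r x).
Proof.
move=> a0; apply: ac2_C1 => x /andP[ax _]; have x0 := lt_le_trans a0 ax.
  exact: Dr.
have cr := is_derive_continuous (Dr x0).
by apply: continuousB; [exact: cW|exact: continuousM].
Qed.

(* The Darboux factorisation: [(v' - r v)^2 = v'^2 + W v^2 - (r v^2)']. *)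
Let factor a b : 0 < a -> a <= b ->
  itg `[a, b] (fun x => (dv x - r x * v x) ^+ 2) /\
  \int[mu]_(x in `[a, b]) (dv x - r x * v x) ^+ 2 =
  \int[mu]_(x in `[a, b]) q x - (r b * v b ^+ 2 - r a * v a ^+ 2).
Proof.
move=> a0 ab; have av : ac2 a b v dv by apply: ac2_sub (H1_ac2 b Hv) => //; exact: ltW.
have mA : msb `[a, b]%classic by [].
have [_ sg E] := ac2_mul (acr b a0) (ac2_mul av av).
have Iq : itg `[a, b] q by apply: itg_sub itgq => //; apply: itv_halfline; exact: ltW.
have Ig := sqi_itg sg.
have EE x : q x - (v x * v x * (W x - r x * r x) + r x * (v x * dv x + v x * dv x)) =
    (dv x - r x * v x) ^+ 2 by rewrite /q; ring.
split; first by apply: itg_eq (itgB mA Iq Ig) => // x _; exact: EE.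
rewrite !expr2 (E a b)// -RintegralB//.
by apply: eq_Rintegral => x _; rewrite -EE.
Qed.

(** Enlarging [a, b] to [1 / (n + 1), n + 1] increases the integral of the square, which there
    equals the integral of [q] minus boundary terms that tend to 0. *)
Let factor_le a b : 0 < a -> a <= b ->
  \int[mu]_(x in `[a, b]) (dv x - r x * v x) ^+ 2 <= hint q.
Proof.
move=> a0 ab.
have C1 : (\int[mu]_(x in `[n.+1%:R^-1, n.+1%:R]) q x -
    (r n.+1%:R * v n.+1%:R ^+ 2 - r n.+1%:R^-1 * v n.+1%:R^-1 ^+ 2))
    @[n --> \oo] --> hint q - (0 - 0).
  apply: cvgB; first exact: Rint_Vn_cvg.
  apply: cvgB => //.
  apply: norm_cvg0.
  have := H1_decay Hv => D.
  have D2 : C * v n.+1%:R ^+ 2 @[n --> \oo] --> (0 : R).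
    by rewrite -[X in _ --> X](mulr0 C); apply: cvgMr.
  apply: (squeeze_cvgr _ (cvg_cst 0) D2); apply: nearW => n.
  rewrite normr_ge0/= normrM [X in _ * X]ger0_norm ?sqr_ge0//.
  by apply: ler_wpM2r; rewrite ?sqr_ge0// rC// ler1n.
rewrite subr0 subr0 in C1.
rewrite -(cvg_lim _ C1)//; apply: limr_ge; first exact: cvgP C1.
near=> n.
have na : n.+1%:R^-1 <= a.
  rewrite -[leRHS]invrK lef_pV2 ?posrE ?invr_gt0//.
  apply: (@le_trans _ _ n%:R); last by rewrite ler_nat.
  by near: n; exact: nbhs_infty_ger.
have nb : b <= n.+1%:R.
  apply: (@le_trans _ _ n%:R); last by rewrite ler_nat.
  by near: n; exact: nbhs_infty_ger.
have e0 : 0 < n.+1%:R^-1 :> R by rewrite invr_gt0.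
have [I <-] := factor e0 (invn_le R n).
have I2 : itg `[a, n.+1%:R] (fun x => (dv x - r x * v x) ^+ 2).
  by apply: itg_sub I => //; exact: itv_sub.
rewrite (Rint_split na (le_trans ab nb) I) (Rint_split ab nb I2).
rewrite addrCA lerDl addr_ge0//; apply: Rintegral_ge0 => x _; exact: sqr_ge0.
Unshelve. all: by end_near. Qed.

Lemma jacobi_ge0 : 0 <= hint (fun x => dv x ^+ 2 + W x * v x ^+ 2).
Proof.
apply: le_trans (factor_le ltr01 (lexx 1)).
by apply: Rintegral_ge0 => x _; exact: sqr_ge0.
Qed.

(** If the form vanishes, [factor_le] makes v' - r v null on every compact interval of the open half
    line. Since (v / psi)' = (v' - r v) / psi, the quotient v / psi is constant there; the vertex is
    reached by continuity. *)
Lemma jacobi_eq0 : hint (fun x => dv x ^+ 2 + W x * v x ^+ 2) = 0 ->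
  exists c, forall x, 0 <= x -> v x = c * psi x.
Proof.
move=> q0.
have const a b : 0 < a -> a <= b -> v b / psi b = v a / psi a.
  move=> a0 ab; pose h x := (psi x)^-1.
  have ah : ac2 a b h (fun x => - (r x * h x)).
    apply: ac2_C1 => x /andP[ax _]; have x0 := lt_le_trans a0 ax; have n0 := psi_neq0 x0.
      have := is_derive_invf (Dpsi x) n0; move/is_derive_eq; apply.
      by rewrite /r /h; field.
    have ch := is_derive_continuous (is_derive_invf (Dpsi x) n0).
    apply: continuousN; apply: continuousM => //.
    exact: is_derive_continuous (Dr x0).
  have av : ac2 a b v dv by apply: ac2_sub (H1_ac2 b Hv) => //; exact: ltW.
  have [_ sg E] := ac2_mul av ah.
  have mA : msb `[a, b]%classic by [].
  have sd : sqi `[a, b] (fun x => dv x - r x * v x).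
    have [[mv sdv _] [mr _ _]] := (av, acr b a0).
    have [I _] := factor a0 ab; split => //.
    by apply: measurable_funB; [exact: sdv.1|exact: measurable_funM].
  have [B hB] := ac2_bounded ah.
  have Z : \int[mu]_(x in `[a, b]) `|dv x - r x * v x| = 0.
    have := cauchy_schwarz_itv ab sd.
    have -> : \int[mu]_(x in `[a, b]) (dv x - r x * v x) ^+ 2 = 0.
      apply/eqP; rewrite eq_le Rintegral_ge0 ?andbT; last by move=> x _; exact: sqr_ge0.
      by rewrite -[leRHS]q0; exact: factor_le.
    rewrite mulr0 => H; apply/eqP; rewrite -sqrf_eq0 eq_le H/=; exact: sqr_ge0.
  apply/eqP; rewrite -subr_eq0 E// -normr_le0.
  apply: le_trans (le_normr_Rintegral _ (sqi_itg sg)) _ => //.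
  have In := itg_norm mA (sqi_itg sd).
  apply: (@le_trans _ _ (\int[mu]_(x in `[a, b]) (B * `|dv x - r x * v x|))).
    apply: le_Rintegral => //; [exact: itg_norm (sqi_itg sg)|exact: itgZ|].
    move=> x xab; rewrite (_ : _ + _ = h x * (dv x - r x * v x)); last by ring.
    by rewrite normrM; apply: ler_wpM2r => //; exact: hB.
  by rewrite RintegralZl// Z mulr0.
pose c := v 1 / psi 1.
have vc x : 0 < x -> v x = c * psi x.
  move=> x0; have n0 := psi_neq0 x0; rewrite -[LHS](divfK n0); congr (_ * _).
  by have [x1|/ltW x1] := leP x 1; [rewrite -(const x 1)|rewrite (const 1 x)].
exists c => x; rewrite le_eqVlt => /predU1P[<-|/vc//].
(* The quotient is of no help at 0, where psi may vanish (psi = phi' does). Instead f = v - c psi is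
   absolutely continuous on [0, 1] and zero on (0, 1], so f(0)^2 <= e G for all e in (0, 1]. *)
have ap : ac2 0 1 psi dpsi.
  by apply: ac2_C1 => // z _; exact: is_derive_continuous (Ddpsi z).
have [mf sf E] := ac2_lin 1 (- c) (H1_ac2 1 Hv) ap.
pose f x := 1 * v x + - c * psi x; pose df x := 1 * dv x + - c * dpsi x.
set G := \int[mu]_(x in `[0, 1]) df x ^+ 2.
suff f0 : f 0 = 0 by move: f0; rewrite /f; lra.
have fe e : 0 < e -> e <= 1 -> f 0 ^+ 2 <= e * G.
  move=> e0 e1.
  have A := ac2_sub (lexx 0) e1 (ac2_lin 1 (- c) (H1_ac2 1 Hv) ap).
  have [_ se _] := A.
  have := ac2_osc A (ltW e0) (lexx e) (lexx 0) (ltW e0).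
  have -> : 1 * v e + - c * psi e = 0 by rewrite vc//; ring.
  rewrite subr0 => H; rewrite -(real_normK (num_real (f 0))).
  apply: le_trans (_ : _ <= (\int[mu]_(t in `[0, e]) `|df t|) ^+ 2) _.
    by apply: lerXn2r; rewrite ?nnegrE// (le_trans _ H).
  apply: le_trans (cauchy_schwarz_itv (ltW e0) se) _.
  rewrite subr0; apply: ler_wpM2l; first exact: ltW.
  rewrite /G (Rint_split (ltW e0) e1 sf.2) lerDl.
  by apply: Rintegral_ge0 => z _; exact: sqr_ge0.
apply/eqP; rewrite -sqrf_eq0; apply/negPn/negP => f0.
have fp : 0 < f 0 ^+ 2 by rewrite lt_neqAle eq_sym f0 sqr_ge0.
have G0 : 0 <= G by apply: Rintegral_ge0 => z _; exact: sqr_ge0.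
have G1 := fe 1 ltr01 (lexx 1); rewrite mul1r in G1.
have Gp : 0 < G by exact: lt_le_trans G1.
have G2 : 0 < 2 * G by lra.
(* This e is at most 1 / 2 because f(0)^2 <= G, and it yields f(0)^2 <= f(0)^2 / 2. *)
have := fe (f 0 ^+ 2 / (2 * G)); rewrite (divr_gt0 fp G2).
rewrite (ler_pdivrMr _ _ G2) => /(_ isT).
have -> : f 0 ^+ 2 / (2 * G) * G = f 0 ^+ 2 / 2 by field; rewrite gt_eqF.
move=> H; have /H : f 0 ^+ 2 <= 1 * (2 * G) by lra.
by lra.
Qed.

End Jacobi.

(** * The quadratic forms of one edge *)

Section QuadraticForms.
Variables (R : realType) (p : R).
Hypothesis p_gt0 : 0 < p.
Local Notation mu := (@lebesgue_measure R).
Local Notation HL := (@halfline R).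
Local Notation phi := (@phi R p).
Local Notation T := (tanhp p).
Local Notation dphi := (dphi p).
Local Notation d2phi := (d2phi p).
Local Notation Wplus := (Wplus p).
Local Notation Wminus := (Wminus p).
Local Notation theta := (theta p).
Local Notation dtheta := (dtheta p).
Implicit Types (v dv : R -> R) (x : R).

Let mHL := @halfline_measurable R.

Definition Qplus v dv := hint (fun x => dv x ^+ 2 + Wplus x * v x ^+ 2).
Definition Qminus v dv := hint (fun x => dv x ^+ 2 + Wminus x * v x ^+ 2).

Let dphiE x : dphi x = - (T x * phi x).
Proof. by []. Qed.

Let r_minus x : dphi x / phi x = - T x.
Proof. by rewrite dphiE -mulNr mulfK// gt_eqF// phi_gt0. Qed.

Let phi_neq0 x : 0 < x -> phi x != 0.
Proof. by move=> _; rewrite gt_eqF// phi_gt0. Qed.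

Let r_minus_le x : 1 <= x -> `|dphi x / phi x| <= 1.
Proof. by move=> _; rewrite r_minus normrN tanhp_norm_le1. Qed.

Let vertex_minus v dv : H1 v dv ->
  dphi n.+1%:R^-1 / phi n.+1%:R^-1 * v n.+1%:R^-1 ^+ 2 @[n --> \oo] --> (0 : R).
Proof.
move=> Hv; have [M [M0 vM]] := H1_bounded Hv.
have CT : T n.+1%:R^-1 @[n --> \oo] --> (0 : R).
  have := is_derive_continuous (is_derive_tanhp p 0).
  rewrite /prop_for /continuous_at tanhp0 => CT.
  exact: (cvg_comp _ _ (@cvg_harmonic R) CT).
have C2 : M ^+ 2 * `|T n.+1%:R^-1| @[n --> \oo] --> (0 : R).
  by rewrite -[X in _ --> X](mulr0 (M ^+ 2)); apply: cvgMr; rewrite -(@normr0 _ R); exact: cvg_norm.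
apply: norm_cvg0; apply: (squeeze_cvgr _ (cvg_cst 0) C2); apply: nearW => n.
rewrite normr_ge0/= r_minus normrM normrN mulrC; apply: ler_wpM2r => //.
rewrite normrX; apply: lerXn2r; rewrite ?nnegrE//.
by apply: vM; rewrite invr_ge0.
Qed.

Lemma Qminus_ge0 v dv : H1 v dv -> 0 <= Qminus v dv.
Proof.
move=> Hv; exact: (@jacobi_ge0 R phi dphi Wminus v dv (p + 2) 1 (is_derive_phi p_gt0)
  (is_derive_dphi p_gt0) (@continuous_Wminus R p) (Wminus_norm_le p_gt0)
  phi_neq0 Hv r_minus_le (vertex_minus Hv)).
Qed.

Lemma Qminus_eq0 v dv : H1 v dv -> Qminus v dv = 0 ->
  exists c, forall x, 0 <= x -> v x = c * phi x.
Proof.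
move=> Hv; exact: (@jacobi_eq0 R phi dphi Wminus v dv (p + 2) 1 (is_derive_phi p_gt0)
  (is_derive_dphi p_gt0) (@continuous_Wminus R p) (Wminus_norm_le p_gt0)
  phi_neq0 Hv r_minus_le (vertex_minus Hv)).
Qed.

(** The quotient phi'' / phi' equals - W- / T, so [tanhp_lower] turns the simple zero of T at the
    vertex into an explicit bound. *)
Let r_plus x : 0 < x -> `|d2phi x / dphi x| <= (p + 2) * (1 + (p * x)^-1).
Proof.
move=> x0; have T0 := tanhp_gt0 p_gt0 x0; have f0 := phi_gt0 p x.
have -> : d2phi x / dphi x = - (Wminus x / T x).
  by rewrite dphiE -[d2phi x]/(Wminus x * phi x); field; rewrite !gt_eqF.
have px : 0 < p * x by rewrite mulr_gt0.
rewrite normrN normrM; apply: ler_pM => //; first exact: Wminus_norm_le.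
rewrite ger0_norm ?invr_ge0 ?(ltW T0)//.
rewrite -[leRHS]invrK lef_pV2 ?posrE ?invr_gt0 ?addr_gt0 ?invr_gt0//.
apply: le_trans (tanhp_lower p_gt0 (ltW x0)).
have y1 : 1 + p * x != 0 by rewrite gt_eqF// addr_gt0.
have y0 : p * x != 0 by rewrite gt_eqF.
have y2 : p * x + 1 != 0 by rewrite addrC.
move: (p * x) y0 y1 y2 => y y0 y1 y2; rewrite le_eqVlt; apply/orP; left; apply/eqP.
by field; rewrite ?y0 ?y1 ?y2.
Qed.

Let dphi_neq0 x : 0 < x -> dphi x != 0.
Proof. by move=> x0; rewrite lt_eqF// dphi_lt0. Qed.

Let r_plus_le x : 1 <= x -> `|d2phi x / dphi x| <= (p + 2) * (1 + p^-1).
Proof.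
move=> x1; have x0 : 0 < x by exact: lt_le_trans x1.
apply: le_trans (r_plus x0) _; have p0 := p_gt0; apply: ler_wpM2l; first by lra.
by rewrite lerD2l lef_pV2 ?posrE ?mulr_gt0// ler_peMr// ltW.
Qed.

(** At x = 1 / (n + 1) the bound [r_plus] is at most a constant times n + 1, the weight that
    [H1_vertex] tolerates. *)
Let vertex_plus v dv : H1 v dv -> v 0 = 0 ->
  d2phi n.+1%:R^-1 / dphi n.+1%:R^-1 * v n.+1%:R^-1 ^+ 2 @[n --> \oo] --> (0 : R).
Proof.
move=> Hv v0; have p0 := p_gt0.
have C2 : (p + 2) * (1 + p^-1) * (n.+1%:R * v n.+1%:R^-1 ^+ 2) @[n --> \oo] --> (0 : R).
  by rewrite -[X in _ --> X](mulr0 ((p + 2) * (1 + p^-1))); apply: cvgMr; exact: H1_vertex Hv v0.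
apply: norm_cvg0; apply: (squeeze_cvgr _ (cvg_cst 0) C2); apply: nearW => n.
have e0 : 0 < n.+1%:R^-1 :> R by rewrite invr_gt0.
rewrite normr_ge0/= normrM normrX real_normK ?num_real// mulrA; apply: ler_wpM2r.
  exact: sqr_ge0.
apply: le_trans (r_plus e0) _; rewrite -mulrA; apply: ler_wpM2l; first by lra.
rewrite invfM invrK mulrDl mul1r lerD2r ler1n//.
Qed.

Lemma Qplus_ge0 v dv : H1 v dv -> v 0 = 0 -> 0 <= Qplus v dv.
Proof.
move=> Hv v0; exact: (@jacobi_ge0 R dphi d2phi Wplus v dv _ _ (is_derive_dphi p_gt0)
  (is_derive_d2phi p_gt0) (@continuous_Wplus R p) (Wplus_norm_le p_gt0)
  dphi_neq0 Hv r_plus_le (vertex_plus Hv v0)).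
Qed.

Lemma Qplus_eq0 v dv : H1 v dv -> v 0 = 0 -> Qplus v dv = 0 ->
  exists c, forall x, 0 <= x -> v x = c * dphi x.
Proof.
move=> Hv v0; exact: (@jacobi_eq0 R dphi d2phi Wplus v dv _ _ (is_derive_dphi p_gt0)
  (is_derive_d2phi p_gt0) (@continuous_Wplus R p) (Wplus_norm_le p_gt0)
  dphi_neq0 Hv r_plus_le (vertex_plus Hv v0)).
Qed.

Lemma itg_bilinear v dv w dw : H1 v dv -> H1 w dw ->
  itg HL (fun x => dv x * dw x + Wplus x * (v x * w x)).
Proof.
move=> Hv Hw; have [sv sdv] := H1_sqi Hv; have [sw sdw] := H1_sqi Hw.
apply: itgD => //; first exact: sqi_mul.
apply: (itg_bmul (c := 1 + (p + 1) * (2 * p + 1))) => //; last exact: sqi_mul.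
- by apply: measurable_funTS; apply: continuous_measurable_fun; exact: continuous_Wplus.
- by move=> x _; exact: Wplus_norm_le.
Qed.

(* [L theta = - phi], where [L] is the operator of [Qplus]; the vertex term of the
   integration by parts vanishes because [dtheta 0 = 0]. *)
Lemma bilinear_theta v dv : H1 v dv ->
  hint (fun x => dv x * dtheta x + Wplus x * (v x * theta x)) = - hint (fun x => v x * phi x).
Proof.
move=> Hv; have [sv sdv] := H1_sqi Hv; have [sf _] := H1_sqi (H1_phi p_gt0).
have I1 := itg_bilinear Hv (H1_theta p_gt0); have I2 := sqi_mul mHL sv sf.
apply/eqP; rewrite -addr_eq0 -hintD//; apply/eqP.
have I := itgD mHL I1 I2.
have C1 := Rint_0n_cvg I; have [B B0 dB] := dtheta_bounded p_gt0.
have C2 : v n.+1%:R * dtheta n.+1%:R @[n --> \oo] --> (0 : R).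
  have C3 : B * `|v n.+1%:R| @[n --> \oo] --> (0 : R).
    rewrite -[X in _ --> X](mulr0 B); apply: cvgMr; rewrite -(@normr0 _ R).
    by apply: cvg_norm; exact: H1_cvg0 Hv.
  apply: norm_cvg0; apply: (squeeze_cvgr _ (cvg_cst 0) C3); apply: nearW => n.
  by rewrite normr_ge0/= normrM mulrC; apply: ler_wpM2r => //; exact: dB.
apply: cvg_unique C2 => //=.
suff <- : (fun n : nat => \int[mu]_(x in `[0, n.+1%:R]) (dv x * dtheta x +
    Wplus x * (v x * theta x) + v x * phi x)) = (fun n : nat => v n.+1%:R * dtheta n.+1%:R) by [].
apply/funext => n.
have at_ : ac2 0 n.+1%:R dtheta (fun x => Wplus x * theta x + phi x).
  apply: ac2_C1 => x _; first exact: is_derive_dtheta.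
  apply: continuousD; last exact: is_derive_continuous (is_derive_phi p_gt0 x).
  apply: continuousM; first exact: continuous_Wplus.
  exact: is_derive_continuous (is_derive_theta p_gt0 x).
have [_ _ H] := ac2_mul (H1_ac2 n.+1%:R Hv) at_.
have E0 : v 0 * dtheta 0 = 0 by rewrite dtheta0 mulr0.
apply: etrans (etrans (congr1 (fun z => v n.+1%:R * dtheta n.+1%:R - z) E0) (subr0 _)).
apply: etrans (esym (H 0 n.+1%:R (lexx 0) (ler0n _ _) (lexx _))).
by apply: eq_Rintegral => x _; ring.
Qed.

(* With [c = v 0 / theta 0] the shifted function vanishes at the vertex. *)
Lemma Qplus_shift v dv c : H1 v dv ->
  Qplus v dv = Qplus (fun x => 1 * v x + - c * theta x) (fun x => 1 * dv x + - c * dtheta x)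
    - 2 * c * hint (fun x => v x * phi x) + c ^+ 2 * hint (fun x => theta x * phi x).
Proof.
move=> Hv; have Ht := H1_theta p_gt0.
have E := bilinear_theta Hv; have Et := bilinear_theta Ht.
(* Once both pairings with phi are read as values of the bilinear form, the claim is the expansion
   of the form at v - c theta. *)
have -> : hint (fun x => v x * phi x) =
  - hint (fun x => dv x * dtheta x + Wplus x * (v x * theta x)) by rewrite E opprK.
have -> : hint (fun x => theta x * phi x) =
  - hint (fun x => dtheta x * dtheta x + Wplus x * (theta x * theta x)) by rewrite Et opprK.
have Iv := itg_bilinear Hv Hv; have Ivt := itg_bilinear Hv Ht; have It := itg_bilinear Ht Ht.
have -> : Qplus (fun x => 1 * v x + - c * theta x) (fun x => 1 * dv x + - c * dtheta x) =
    hint (fun x => dv x * dv x + Wplus x * (v x * v x) +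
      (- (2 * c) * (dv x * dtheta x + Wplus x * (v x * theta x)) +
      c ^+ 2 * (dtheta x * dtheta x + Wplus x * (theta x * theta x)))).
  by apply: eq_hint => x _; ring.
rewrite (hintD Iv (itgD mHL (itgZ (- (2 * c)) mHL Ivt) (itgZ (c ^+ 2) mHL It))).
rewrite (hintD (itgZ (- (2 * c)) mHL Ivt) (itgZ (c ^+ 2) mHL It)) (hintZ _ Ivt) (hintZ _ It).
have -> : Qplus v dv = hint (fun x => dv x * dv x + Wplus x * (v x * v x)).
  by apply: eq_hint => x _; ring.
ring.
Qed.

(** The integrand is (phi^2 / 2)'. That the value is nonzero later converts orthogonality to Phi
    into a linear condition on the coefficients of phi'. *)
Lemma hint_phi_dphi : hint (fun x => dphi x * phi x) = - (phi 0 ^+ 2 / 2).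
Proof.
have [sf sdf] := H1_sqi (H1_phi p_gt0); have I := sqi_mul mHL sdf sf.
have C1 := Rint_0n_cvg I.
have C2 : 2^-1 * (phi n.+1%:R ^+ 2 - phi 0 ^+ 2) @[n --> \oo] --> 2^-1 * (0 - phi 0 ^+ 2).
  apply: cvgMr; apply: cvgB; first exact: H1_decay (H1_phi p_gt0).
  exact: cvg_cst.
have -> : - (phi 0 ^+ 2 / 2) = 2^-1 * (0 - phi 0 ^+ 2) by ring.
apply: cvg_unique C2 => //=.
suff <- : (fun n : nat => \int[mu]_(x in `[0, n.+1%:R]) (dphi x * phi x)) =
  (fun n : nat => 2^-1 * (phi n.+1%:R ^+ 2 - phi 0 ^+ 2)) by [].
apply/funext => n; have A := H1_ac2 n.+1%:R (H1_phi p_gt0).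
have [_ sg H] := ac2_mul A A.
have E u w : 2^-1 * (u * u - w * w) = 2^-1 * (u ^+ 2 - w ^+ 2) :> R by ring.
apply: etrans (E _ _).
apply: etrans (congr1 (fun z => 2^-1 * z) (esym (H 0 n.+1%:R (lexx 0) (ler0n _ _) (lexx _)))).
rewrite -RintegralZl; [|exact: measurable_itv|exact: sqi_itg].
by apply: eq_Rintegral => x _; field.
Qed.

(** From |phi'| <= phi follows phi^2 >= - phi' phi, whose integral is phi(0)^2 / 2; no
    almost-everywhere argument is involved. *)
Lemma hint_phi2_gt0 : 0 < hint (fun x => phi x ^+ 2).
Proof.
have [sf sdf] := H1_sqi (H1_phi p_gt0); have I := sqi_mul mHL sdf sf.
have f0 : 0 < phi 0 ^+ 2 by rewrite exprn_gt0// phi_gt0.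
have : - hint (fun x => dphi x * phi x) <= hint (fun x => phi x ^+ 2).
  rewrite -mulN1r -(hintZ _ I); apply: le_hint; [exact: itgZ mHL I|exact: sf.2|].
  move=> x _; have := dphi_norm_le p x; rewrite ler_norml => /andP[].
  have := phi_gt0 p x; move: (phi x) (dphi x) => u d; nra.
rewrite hint_phi_dphi; lra.
Qed.

Lemma hint_dphi2_gt0 : 0 < hint (fun x => dphi x ^+ 2).
Proof.
have [sf sdf] := H1_sqi (H1_phi p_gt0); have I := sqi_mul mHL sdf sf.
have A0 := hint_phi2_gt0; set A := hint _ in A0.
have f0 : 0 < phi 0 ^+ 2 by rewrite exprn_gt0// phi_gt0.
(* The minimiser in t of the integral of (phi' + t phi)^2, whose linear coefficient is - phi(0)^2.
   Nonnegativity there bounds the integral of phi'^2 below by phi(0)^4 / (4 A). *)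
pose t := phi 0 ^+ 2 / (2 * A).
have : 0 <= hint (fun x => dphi x ^+ 2 + (2 * t * (dphi x * phi x) + t ^+ 2 * phi x ^+ 2)).
  apply: hint_ge0 => x _; have := sqr_ge0 (dphi x + t * phi x).
  by move: (phi x) (dphi x) => u d; nra.
rewrite (hintD sdf.2 (itgD mHL (itgZ (2 * t) mHL I) (itgZ (t ^+ 2) mHL sf.2))).
rewrite (hintD (itgZ (2 * t) mHL I) (itgZ (t ^+ 2) mHL sf.2)) (hintZ _ I) (hintZ _ sf.2).
rewrite hint_phi_dphi -/A => H.
have t0 : 0 < t by rewrite divr_gt0// mulr_gt0.
have tA : t * A = phi 0 ^+ 2 / 2 by rewrite /t; field; rewrite gt_eqF.
have : 0 < t * (phi 0 ^+ 2 / 2) by rewrite mulr_gt0//; lra.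
have : t ^+ 2 * A = t * (phi 0 ^+ 2 / 2) by rewrite -tA; ring.
move=> E ?; rewrite E in H; lra.
Qed.

(** Writing x phi phi' / 2 = (x phi^2 / 4)' - phi^2 / 4 gives theta phi = k phi^2 + (x phi^2 / 4)'
    with k = 1/(2p) - 1/4, positive for p < 2. On [0, M] the boundary term is nonnegative and is
    dropped, so only a lower bound passes to the limit. *)
Lemma hint_theta_phi_gt0 : p < 2 -> 0 < hint (fun x => theta x * phi x).
Proof.
move=> p2; have p0 := p_gt0.
have [sf sdf] := H1_sqi (H1_phi p_gt0); have [st _] := H1_sqi (H1_theta p_gt0).
pose k := (2 * p)^-1 - 4^-1.
have k0 : 0 < k by rewrite /k subr_gt0 ltf_pV2 ?posrE; lra.
have kA : 0 < k * hint (fun x => phi x ^+ 2) by rewrite (mulr_gt0 k0 hint_phi2_gt0).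
apply: (lt_le_trans kA).
have C1 := Rint_0n_cvg (sqi_mul mHL st sf).
have C2 : k * \int[mu]_(x in `[0, n.+1%:R]) phi x ^+ 2 @[n --> \oo] -->
    k * hint (fun x => phi x ^+ 2).
  by apply: cvgMr; apply: Rint_0n_cvg; exact: sf.2.
apply: ler_cvg_to C2 C1 _; apply: nearW => n.
pose M : R := n.+1%:R.
have D x : is_derive x 1 (fun y => y * (phi y * phi y) / 4)
    (4^-1 * (phi x ^+ 2) + 2^-1 * (x * (phi x * dphi x))).
  have H := is_derive_phi p_gt0 x; rewrite -[X in is_derive _ _ _ X]/(dphi x) in H.
  have := is_derive_mulf (is_derive_mulf (is_derive_idf x) (is_derive_mulf H H))
    (is_derive_cstf 4^-1 x).
  by move/is_derive_eq; apply; field.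
have Dc x : {for x, continuous (fun x => 4^-1 * (phi x ^+ 2) + 2^-1 * (x * (phi x * dphi x)))}.
  have H := is_derive_phi p_gt0 x; have H2 := is_derive_dphi p_gt0 x.
  exact: is_derive_continuous (is_derive_addf (is_derive_scalef 4^-1 (is_derive_sqrf H))
    (is_derive_scalef 2^-1 (is_derive_mulf (is_derive_idf x) (is_derive_mulf H H2)))).
have [_ sg /(_ 0 M)] : ac2 0 M (fun y => y * (phi y * phi y) / 4)
    (fun x => 4^-1 * (phi x ^+ 2) + 2^-1 * (x * (phi x * dphi x))).
  exact: (ac2_C1 (fun x _ => D x) (fun x _ => Dc x)).
rewrite !mul0r subr0 => E.
have sub : (`[0%R, M] `<=` HL)%classic by exact: itv_halfline.
have I2 : itg `[0, M] (fun x => phi x ^+ 2) by apply: itg_sub sf.2.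
have -> : \int[mu]_(x in `[0, M]) (theta x * phi x) = \int[mu]_(x in `[0, M])
    (k * (phi x ^+ 2) + (4^-1 * (phi x ^+ 2) + 2^-1 * (x * (phi x * dphi x)))).
  by apply: eq_Rintegral => x _; rewrite -[theta x]/(phi x / (2 * p) + x * dphi x / 2) /k; ring.
rewrite RintegralD; [|exact: measurable_itv|exact: itgZ|exact: sqi_itg].
rewrite RintegralZl; [|exact: measurable_itv|exact: I2].
rewrite lerDl -E; [|exact: lexx|exact: ler0n|exact: lexx].
by rewrite divr_ge0// mulr_ge0// mulr_ge0// ltW// phi_gt0.
Qed.

End QuadraticForms.

(** * Differentiation of the action under the integral sign *)

Section SecondVariation.
Variable R : realType.
Local Notation mu := (@lebesgue_measure R).
Local Notation HL := (@halfline R).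
Let mHL := @halfline_measurable R.
Implicit Types (s t x : R).

(** The parameter stays in |t| < S because the majorants used below grow with S. *)
Lemma is_derive_hint (F dF : R -> R -> R) (G : R -> R) (s S : R) : `|s| < S ->
  (forall t, `|t| < S -> itg HL (F t)) ->
  (forall t x, `|t| < S -> 0 <= x -> is_derive t 1 (F^~ x) (dF t x)) ->
  (forall x, 0 <= G x) -> itg HL G ->
  (forall t x, `|t| < S -> 0 <= x -> `|dF t x| <= G x) ->
  is_derive s 1 (fun t => hint (F t)) (hint (dF s)).
Proof.
move=> sS IF DF G0 IG FG.
have inS t : `](- S), S[%classic t -> `|t| < S by rewrite /= in_itv/= ltr_norml.
have Is : `](- S), S[%classic s by rewrite /= in_itv/= -ltr_norml.
have E t x : `|t| < S -> 0 <= x -> partial1of2 F t x = dF t x.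
  by move=> tS x0; rewrite partial1of2E; have [] := DF t x tS x0.
have df t x : `](- S), S[%classic t -> HL x -> derivable (F^~ x) t 1.
  by move=> /inS tS /halflineP x0; have [] := DF t x tS x0.
have IF' t : `](- S), S[%classic t -> mu.-integrable HL (EFin \o F t).
  by move=> /inS; exact: IF.
have FG' t x : `](- S), S[%classic t -> HL x -> `|partial1of2 F t x| <= G x.
  by move=> /inS tS /halflineP x0; rewrite E//; exact: FG.
apply: DeriveDef.
  exact: (derivable_under_integral mHL Is IF' df G0 IG FG').
rewrite -derive1E.
apply: etrans (differentiation_under_integral mHL Is IF' df G0 IG FG') _.
by apply: eq_hint => x x0; exact: E.
Qed.

Lemma powR_cvg0_nneg (p t0 : R) (q : R -> R) : 0 < p -> (forall t, 0 <= q t) ->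
  q t @[t --> t0] --> (0 : R) -> powR (q t) p @[t --> t0] --> (0 : R).
Proof.
move=> p0 q0 /cvgr0Pnorm_lt Cq; apply/cvgr0Pnorm_lt => e e0.
have := Cq (powR e p^-1) (powR_gt0 _ e0); apply: filterS => t.
rewrite (ger0_norm (q0 t)) (ger0_norm (powR_ge0 _ _)) => H.
have -> : e = powR (powR e p^-1) p by rewrite -powRrM mulVf ?gt_eqF// powRr1// ltW.
by apply: gt0_ltr_powR; rewrite ?nnegrE ?powR_ge0.
Qed.

(** The difference quotient at t0 is h itself. This handles zeros of the modulus, where the chain
    rule for [powR] does not apply. *)
Lemma is_derive_mul_sub0 (h : R -> R) (t0 : R) : h t @[t --> t0] --> (0 : R) ->
  is_derive t0 1 (fun t => h t * (t - t0)) 0.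
Proof.
move=> Ch.
have C : (fun u => u^-1 *: ((fun t => h t * (t - t0)) (u *: 1 + t0) -
    (fun t => h t * (t - t0)) t0)) u @[u --> 0^'] --> (0 : R).
  have C1 : h (u + t0) @[u --> 0^'] --> (0 : R).
    apply: cvg_within_filter.
    have : (fun u : R => u + t0) u @[u --> 0] --> t0.
      rewrite -[X in _ --> X]add0r; apply: cvgD; [exact: cvg_id|exact: cvg_cst].
    by move/cvg_comp; apply.
  apply: cvg_trans C1; apply: near_eq_cvg; near=> u.
  have u0 : u != 0 by near: u; exact: nbhs_dnbhs_neq.
  rewrite subrr mulr0 subr0 /GRing.scale/= mulr1 addrK.
  by rewrite mulrCA mulVf// mulr1.
apply: DeriveDef; first by apply/cvg_ex; exists 0.
exact/cvg_lim.
Unshelve. all: by end_near. Qed.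

End SecondVariation.

(** * Powers of the squared modulus along a line, at one point of the graph *)

Section PowerOfQuadratic.
Variable R : realType.
Variables (p f a b : R).
Hypothesis p_gt0 : 0 < p.
Implicit Types (t : R).

(** The squared modulus of f + t (a + i b) for real f. The summand 0 is the imaginary part of [Phi],
    kept so that the integrands of [Lambda] match by conversion. *)
Definition quad (f a b t : R) : R := (f + t * a) ^+ 2 + (0 + t * b) ^+ 2.
Definition dquad (f a b t : R) : R := 2 * ((f + t * a) * a + t * b ^+ 2).
Local Notation q := (quad f a b).
Local Notation dq := (dquad f a b).

Lemma quad_ge0 t : 0 <= q t.
Proof. by rewrite addr_ge0// sqr_ge0. Qed.

Lemma is_derive_quad t : is_derive t 1 q (dq t).
Proof.
have L (u v : R) : is_derive t 1 (fun t => u + t * v) v.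
  have := is_derive_addf (is_derive_cstf u t) (is_derive_mulf (is_derive_idf t) (is_derive_cstf v t)).
  by move/is_derive_eq; apply; ring.
have := is_derive_addf (is_derive_sqrf (L f a)) (is_derive_sqrf (L 0 b)).
by move/is_derive_eq; apply; rewrite /dquad; ring.
Qed.

Lemma is_derive_dquad t : is_derive t 1 dq (2 * (a ^+ 2 + b ^+ 2)).
Proof.
have := is_derive_scalef 2 (is_derive_addf (is_derive_mulf (is_derive_addf (is_derive_cstf f t)
  (is_derive_mulf (is_derive_idf t) (is_derive_cstf a t))) (is_derive_cstf a t))
  (is_derive_mulf (is_derive_idf t) (is_derive_cstf (b ^+ 2) t))).
by move/is_derive_eq; apply; ring.
Qed.

(* Cauchy-Schwarz in the plane. *)
Lemma dquad_sqr_le t : dq t ^+ 2 <= 4 * (a ^+ 2 + b ^+ 2) * q t.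
Proof.
rewrite /quad /dquad; have := sqr_ge0 ((f + t * a) * b - t * b * a); nra.
Qed.

(** A sum of two squares of affine functions vanishes only where both do, so a root is a double
    root. *)
Lemma quad_zero t0 : q t0 = 0 -> forall t,
  q t = (a ^+ 2 + b ^+ 2) * (t - t0) ^+ 2 /\ dq t = 2 * (a ^+ 2 + b ^+ 2) * (t - t0).
Proof.
rewrite /quad add0r => /eqP; rewrite paddr_eq0 ?sqr_ge0// !sqrf_eq0 => /andP[/eqP h1 /eqP h2] t.
have hf : f = - (t0 * a) by lra.
have hb u : u * b = (u - t0) * b by rewrite mulrBl h2 subr0.
split; first by rewrite add0r (hb t) hf; ring.
rewrite /dquad hf expr2 mulrA (hb t); ring.
Qed.

Let powq_cvg0 t0 : q t0 = 0 -> powR (q t) p @[t --> t0] --> (0 : R).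
Proof.
move=> q0; apply: powR_cvg0_nneg => //; first exact: quad_ge0.
by rewrite -[X in _ --> X]q0; exact: is_derive_continuous (is_derive_quad t0).
Qed.

(** Away from roots this is the chain rule. At a root t, q(u)^(p+1) = q(u)^p c (u - t)^2 with c =
    a^2 + b^2, and [is_derive_mul_sub0] applies. *)
Lemma is_derive_quad_powS t :
  is_derive t 1 (fun t => powR (q t) (p + 1)) ((p + 1) * powR (q t) p * dq t).
Proof.
have [q0|q0] := eqVneq (q t) 0; last first.
  have qp : 0 < q t by rewrite lt_neqAle eq_sym q0 quad_ge0.
  have := is_derive1_comp (is_derive1_powR (p + 1) qp) (is_derive_quad t).
  by rewrite addrK.
have E : (fun u => powR (q u) (p + 1)) =
    (fun u => (powR (q u) p * ((a ^+ 2 + b ^+ 2) * (u - t))) * (u - t)).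
  apply/funext => u; have [qu _] := quad_zero q0 u.
  have p1 : 0 < p + 1 by rewrite addr_gt0.
  rewrite -mulr_powRB1 ?quad_ge0// addrK {1}qu; ring.
have [_ dq0] := quad_zero q0 t; rewrite dq0 subrr !mulr0 E.
apply: is_derive_mul_sub0; rewrite -[X in _ --> X](mul0r 0); apply: cvgM.
  exact: powq_cvg0.
have D := is_derive_scalef (a ^+ 2 + b ^+ 2) (is_derive_subf (is_derive_idf t) (is_derive_cstf t t)).
have := is_derive_continuous D; rewrite /prop_for /continuous_at subrr mulr0; exact.
Qed.

Lemma is_derive_quad_pow_dquad t : is_derive t 1 (fun t => powR (q t) p * dq t)
  (p * powR (q t) (p - 1) * dq t ^+ 2 + powR (q t) p * (2 * (a ^+ 2 + b ^+ 2))).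
Proof.
have [q0|q0] := eqVneq (q t) 0; last first.
  have qp : 0 < q t by rewrite lt_neqAle eq_sym q0 quad_ge0.
  have := is_derive_mulf (is_derive1_comp (is_derive1_powR p qp) (is_derive_quad t))
    (is_derive_dquad t).
  by move/is_derive_eq; apply; rewrite /comp; ring.
have E : (fun u => powR (q u) p * dq u) =
    (fun u => (powR (q u) p * (2 * (a ^+ 2 + b ^+ 2))) * (u - t)).
  by apply/funext => u; have [_ ->] := quad_zero q0 u; ring.
have [_ dq0] := quad_zero q0 t.
have pn : p != 0 by rewrite gt_eqF.
(* At a root the factor [powR (q t) (p - 1)] is multiplied by dq^2 = 0, so the stated derivative is
   0 whatever [powR] returns at base 0. *)
rewrite dq0 subrr mulr0 expr0n mulr0 add0r q0 powR0// mul0r E.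
apply: is_derive_mul_sub0; rewrite -[X in _ --> X](mul0r (2 * (a ^+ 2 + b ^+ 2))).
by apply: cvgM; [exact: powq_cvg0|exact: cvg_cst].
Qed.

(** The bound dq^2 <= 4 (a^2 + b^2) q trades q^(p-1) dq^2 for q^p, which stays bounded at zeros of q
    even when p < 1. *)
Lemma derive_quad_pow_dquad_le t :
  `|p * powR (q t) (p - 1) * dq t ^+ 2 + powR (q t) p * (2 * (a ^+ 2 + b ^+ 2))| <=
  (4 * p + 2) * (a ^+ 2 + b ^+ 2) * powR (q t) p.
Proof.
have c0 : 0 <= a ^+ 2 + b ^+ 2 by rewrite addr_ge0// sqr_ge0.
have k0 : 0 <= p * powR (q t) (p - 1) by rewrite mulr_ge0 ?powR_ge0// ltW.
rewrite ger0_norm; last first.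
  by apply: addr_ge0; [exact: mulr_ge0 k0 (sqr_ge0 _)|rewrite mulr_ge0 ?powR_ge0//; lra].
have := ler_wpM2l k0 (dquad_sqr_le t).
have : q t * powR (q t) (p - 1) = powR (q t) p by exact: mulr_powRB1 (quad_ge0 t) p_gt0.
move: (a ^+ 2 + b ^+ 2) (q t) (powR (q t) (p - 1)) (powR (q t) p) => c z w u E H.
have -> : (4 * p + 2) * c * u = p * w * (4 * c * z) + u * (2 * c) by rewrite -E; ring.
lra.
Qed.

End PowerOfQuadratic.

(** * First and second derivatives of the nonlinear term on one edge *)

Section NonlinearTerm.
Variables (R : realType) (p : R).
Hypothesis p_gt0 : 0 < p.
Local Notation mu := (@lebesgue_measure R).
Local Notation HL := (@halfline R).
Let mHL := @halfline_measurable R.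
Variables (f a b : R -> R) (M : R).
Hypothesis sf : sqi HL f.
Hypothesis sa : sqi HL a.
Hypothesis sb : sqi HL b.
Hypothesis M_ge0 : 0 <= M.
Hypothesis fM : forall x : R, 0 <= x -> `|f x| <= M.
Hypothesis aM : forall x : R, 0 <= x -> `|a x| <= M.
Hypothesis bM : forall x : R, 0 <= x -> `|b x| <= M.
Implicit Types (s t x : R).

Let q t x := quad (f x) (a x) (b x) t.
Let dq t x := dquad (f x) (a x) (b x) t.

Let mq t : measurable_fun HL (q t).
Proof.
have [[mf _] [ma _] [mb _]] := And3 sf sa sb.
rewrite /q /quad; apply: measurable_funD; apply: measurable_funX.
  by apply: measurable_funD => //; apply: measurable_funM.
by apply: measurable_funD => //; apply: measurable_funM.
Qed.

Let mdq t : measurable_fun HL (dq t).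
Proof.
have [[mf _] [ma _] [mb _]] := And3 sf sa sb.
rewrite /dq /dquad; apply: measurable_funM => //; apply: measurable_funD.
  by apply: measurable_funM => //; apply: measurable_funD => //; apply: measurable_funM.
by apply: measurable_funM => //; exact: measurable_funX.
Qed.

Let mpowq t c : measurable_fun HL (fun x => powR (q t x) c).
Proof. by apply: (measurableT_comp (measurable_powR c)); exact: mq. Qed.

(** A bound for q^p uniform in x and |t| < S. In each majorant one bounded factor q^p is taken out
    through [K], and what remains is at most a constant times the integrable [D]. *)
Let K (S : R) : R := powR ((M + S * M) ^+ 2 + (S * M) ^+ 2) p.

Let powq_le (S : R) t x : `|t| < S -> 0 <= x -> powR (q t x) p <= K S.
Proof.
move=> tS x0; have t0 := normr_ge0 t; have S0 : 0 <= S by exact: le_trans (ltW tS).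
apply: ge0_ler_powR; rewrite ?nnegrE ?quad_ge0//; first exact: ltW.
  by rewrite addr_ge0// sqr_ge0.
have tM u : `|u| <= M -> `|t * u| <= S * M.
  by move=> uM; rewrite normrM; apply: ler_pM => //; exact: ltW.
rewrite /q /quad -[X in X + _](real_normK (num_real _)) -[X in _ + X](real_normK (num_real _)).
apply: lerD; apply: lerXn2r; rewrite ?nnegrE ?addr_ge0 ?mulr_ge0//.
  by apply: le_trans (ler_normD _ _) _; apply: lerD; [exact: fM|apply: tM; exact: aM].
by rewrite add0r; apply: tM; exact: bM.
Qed.

Let D x := f x ^+ 2 + (a x ^+ 2 + b x ^+ 2).

Let itgD3 : itg HL D.
Proof. by apply: itgD mHL sf.2 _; exact: itgD mHL sa.2 sb.2. Qed.

Let D_ge0 x : 0 <= D x.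
Proof. by rewrite !addr_ge0// sqr_ge0. Qed.

Let itg_powqS t : itg HL (fun x => powR (q t x) (p + 1)).
Proof.
pose S : R := `|t| + 1; have tS : `|t| < S by rewrite ltrDl.
apply: (itg_dom mHL (mpowq t _) (itgZ (K S * (2 + 2 * S ^+ 2)) mHL itgD3)) => x /halflineP x0.
have p1 : 0 < p + 1 by rewrite addr_gt0.
rewrite (ger0_norm (powR_ge0 _ _)) -mulr_powRB1 ?quad_ge0// addrK -mulrA mulrC.
apply: ler_pM; rewrite ?powR_ge0 ?quad_ge0//; first exact: powq_le.
have tS2 : t ^+ 2 <= S ^+ 2.
  by rewrite -(real_normK (num_real t)); apply: lerXn2r; rewrite ?nnegrE ?(ltW tS)// (le_trans _ (ltW tS)).
rewrite /q /quad /D add0r.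
have ta := ler_wpM2r (sqr_ge0 (a x)) tS2; have tb := ler_wpM2r (sqr_ge0 (b x)) tS2.
have := mulr_ge0 (sqr_ge0 S) (sqr_ge0 (f x)); have := mulr_ge0 (sqr_ge0 S) (sqr_ge0 (b x)).
have := sqr_ge0 (a x); have := sqr_ge0 (b x); have := sqr_ge0 (f x - t * a x).
by rewrite !exprMn; nra.
Qed.

Let G (S : R) x : R := (p + 1) * K S * (2 + 2 * S) * D x.

Let K_ge0 S : 0 <= K S.
Proof. exact: powR_ge0. Qed.

Let itgG S : itg HL (G S).
Proof. exact: itgZ mHL itgD3. Qed.

Let d1_le (S : R) t x : `|t| < S -> 0 <= x -> `|(p + 1) * (powR (q t x) p * dq t x)| <= G S x.
Proof.
move=> tS x0; have p0 := p_gt0; have S0 : 0 <= S by exact: le_trans (ltW tS).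
rewrite normrM (ger0_norm (_ : 0 <= p + 1)); last by lra.
rewrite /G -!mulrA; apply: ler_wpM2l; first by lra.
rewrite normrM (ger0_norm (powR_ge0 _ _)); apply: ler_pM; rewrite ?powR_ge0//.
  exact: powq_le.
have : `|t * (a x ^+ 2 + b x ^+ 2)| <= S * (a x ^+ 2 + b x ^+ 2).
  rewrite normrM [X in _ * X]ger0_norm ?addr_ge0 ?sqr_ge0//.
  by apply: ler_wpM2r; [rewrite addr_ge0 ?sqr_ge0|exact: ltW].
have := mulr_ge0 S0 (sqr_ge0 (f x)).
have := sqr_ge0 (f x - a x); have := sqr_ge0 (f x + a x); have := sqr_ge0 (a x); have := sqr_ge0 (b x).
rewrite /dq /dquad /D !ler_norml => h1 h2 h3 h4 h5 /andP[h6 h7].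
by apply/andP; split; nra.
Qed.

Lemma is_derive_hint_powS s : is_derive s 1
  (fun t => hint (fun x => powR (quad (f x) (a x) (b x) t) (p + 1)))
  (hint (fun x => (p + 1) * (powR (quad (f x) (a x) (b x) s) p * dquad (f x) (a x) (b x) s))).
Proof.
pose S : R := `|s| + 1; have sS : `|s| < S by rewrite ltrDl.
apply: (@is_derive_hint R (fun t x => powR (q t x) (p + 1))
  (fun t x => (p + 1) * (powR (q t x) p * dq t x)) (G S) s S) => //.
- by move=> t x _ _; rewrite mulrA; exact: is_derive_quad_powS.
- move=> x; have p0 := p_gt0; rewrite /G mulr_ge0 ?D_ge0// mulr_ge0 ?mulr_ge0 ?K_ge0//; first by lra.
  by rewrite /S; have := normr_ge0 s; lra.
- by move=> t x tS x0; exact: d1_le.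
Qed.

(** At s = 0 one has q = f^2 and dq = 2 f a, so p q^(p-1) dq^2 = 4 p f^(2p) a^2. Added to 2 f^(2p)
    (a^2 + b^2), this is the source of the factor 2 p + 1 carried by real parts only. *)
Lemma is_derive_hint_pow_dquad : is_derive (0 : R) 1
  (fun s => hint (fun x => (p + 1) * (powR (quad (f x) (a x) (b x) s) p * dquad (f x) (a x) (b x) s)))
  (hint (fun x => (p + 1) * (powR (f x ^+ 2) p * ((4 * p + 2) * a x ^+ 2 + 2 * b x ^+ 2)))).
Proof.
have p0 := p_gt0.
pose dd (t x : R) : R := (p + 1) * (p * powR (q t x) (p - 1) * dq t x ^+ 2 +
  powR (q t x) p * (2 * (a x ^+ 2 + b x ^+ 2))).
have -> : hint (fun x => (p + 1) * (powR (f x ^+ 2) p * ((4 * p + 2) * a x ^+ 2 + 2 * b x ^+ 2))) =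
    hint (dd 0).
  apply: eq_hint => x _; rewrite /dd.
  have -> : q 0 x = f x ^+ 2 by rewrite /q /quad; ring.
  have -> : dq 0 x = 2 * (f x * a x) by rewrite /dq /dquad; ring.
  have E : f x ^+ 2 * powR (f x ^+ 2) (p - 1) = powR (f x ^+ 2) p.
    exact: mulr_powRB1 (sqr_ge0 _) p_gt0.
  by rewrite -E; ring.
apply: (@is_derive_hint R _ dd
  (fun x => (p + 1) * ((4 * p + 2) * K 1) * D x) 0 1).
- by rewrite normr0.
- move=> t t1; apply: (itg_dom mHL _ (itgG 1)).
    by apply: measurable_funM => //; apply: measurable_funM; [exact: mpowq|exact: mdq].
  by move=> x /halflineP x0; exact: d1_le.
- move=> t x _ _; rewrite /dd; apply: is_derive_scalef; exact: is_derive_quad_pow_dquad.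
- by move=> x; rewrite mulr_ge0 ?D_ge0// mulr_ge0 ?mulr_ge0 ?K_ge0//; lra.
- exact: itgZ mHL itgD3.
- move=> t x t1 x0; rewrite /dd normrM (ger0_norm (_ : 0 <= p + 1)); last by lra.
  rewrite -[leRHS]mulrA; apply: ler_wpM2l; first by lra.
  apply: le_trans (derive_quad_pow_dquad_le _ _ _ p_gt0 _) _.
  rewrite -/(q t x); have := powq_le t1 x0; have := powR_ge0 (q t x) p.
  move: (K 1) (powR (q t x) p) => k u u0 uk.
  rewrite -!mulrA; apply: ler_wpM2l; first by lra.
  rewrite mulrC; apply: ler_pM => //; first by rewrite addr_ge0// sqr_ge0.
  by rewrite /D lerDr sqr_ge0.
Qed.

End NonlinearTerm.

Lemma is_derive_hint_quad (R : realType) (f a b : R -> R) (s : R) :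
  sqi (@halfline R) f -> sqi (@halfline R) a -> sqi (@halfline R) b ->
  is_derive s 1 (fun t => hint (fun x => quad (f x) (a x) (b x) t))
   (2 * hint (fun x => f x * a x) + 2 * s * hint (fun x => a x ^+ 2 + b x ^+ 2)).
Proof.
move=> sf sa sb; have mHL := @halfline_measurable R.
have Ifa := sqi_mul mHL sf sa; have Iab := itgD mHL sa.2 sb.2.
have -> : (fun t => hint (fun x => quad (f x) (a x) (b x) t)) =
    (fun t => hint (fun x => f x ^+ 2) + (t * (2 * hint (fun x => f x * a x)) +
      t ^+ 2 * hint (fun x => a x ^+ 2 + b x ^+ 2))).
  apply/funext => t; rewrite mulrA.
  rewrite -(hintZ (t * 2) Ifa) -(hintZ (t ^+ 2) Iab).
  rewrite -(hintD (itgZ (t * 2) mHL Ifa) (itgZ (t ^+ 2) mHL Iab)).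
  rewrite -(hintD sf.2 (itgD mHL (itgZ (t * 2) mHL Ifa) (itgZ (t ^+ 2) mHL Iab))).
  by apply: eq_hint => x _; rewrite /quad; ring.
have := is_derive_addf (is_derive_cstf (hint (fun x => f x ^+ 2)) s)
  (is_derive_addf (is_derive_mulf (is_derive_idf s) (is_derive_cstf (2 * hint (fun x => f x * a x)) s))
   (is_derive_mulf (is_derive_sqrf (is_derive_idf s))
     (is_derive_cstf (hint (fun x => a x ^+ 2 + b x ^+ 2)) s))).
by move/is_derive_eq; apply; ring.
Qed.

(** * The vectors [e_k] *)

Section Basis.
Variable R : realType.

(** The entries of [ek] indexed by natural numbers, so that sums can be cut at k + 1. *)
Let ekn (k j : nat) : R := if (j < k.+1)%N then 1 else if j == k.+1 then - (k.+1)%:R else 0.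

Let sum_ekn k n (g : nat -> R) : (k < n)%N ->
  \sum_(0 <= j < n.+1) ekn k j * g j = \sum_(0 <= j < k.+1) g j - k.+1%:R * g k.+1.
Proof.
move=> kn; rewrite (@big_cat_nat _ _ _ k.+1)//=; last by rewrite ltnS ltnW.
congr (_ + _).
  by rewrite big_nat [RHS]big_nat; apply: eq_bigr => j /andP[_ jk]; rewrite /ekn jk mul1r.
rewrite big_ltn; last by rewrite ltnS.
rewrite /ekn ltnn eqxx mulNr big1_seq ?addr0// => j /andP[_].
rewrite mem_index_iota => /andP[kj _].
by rewrite ltnNge ltnW// gtn_eqF// mul0r.
Qed.

(** The vector e_k lives on the indices up to k + 1 and has total 0 there. Orthogonality follows
    because, for k < l, the vector e_l is constantly 1 on that range. *)
Lemma sum_ek_const n (k : 'I_n) (g : 'I_n.+1 -> R) (c : R) :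
  (forall j : 'I_n.+1, (j <= k.+1)%N -> g j = c) -> \sum_(j < n.+1) @ek R n.+1 k j * g j = 0.
Proof.
move=> gc; have kn := ltn_ord k.
have -> : \sum_(j < n.+1) @ek R n.+1 k j * g j = \sum_(0 <= j < n.+1) ekn k j * c.
  rewrite big_mkord; apply: eq_bigr => j _; rewrite /ek -/(ekn k j).
  have [/gc->//|jk] := leqP j k.+1.
  by rewrite /ekn ltnNge ltnW//= gtn_eqF// !mul0r.
rewrite (sum_ekn (fun=> c) kn) sumr_const_nat subn0.
by rewrite mulr_natl subrr.
Qed.

Lemma sum_ek n (k : 'I_n) : \sum_(j < n.+1) @ek R n.+1 k j = 0.
Proof.
rewrite -[RHS](@sum_ek_const n k (fun=> 1) 1)//.
by apply: eq_bigr => j _; rewrite mulr1.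
Qed.

Lemma sum_ek_orth n (k l : 'I_n) : k != l ->
  \sum_(j < n.+1) @ek R n.+1 k j * @ek R n.+1 l j = 0.
Proof.
wlog kl : k l / (k < l)%N.
  move=> H kl; have [lt|gt|e] := ltngtP k l; first exact: H.
    by rewrite -[RHS](H l k gt) 1?eq_sym//; apply: eq_bigr => j _; rewrite mulrC.
  by move/negP: kl; case; apply/eqP/val_inj.
move=> _; apply: (@sum_ek_const n k _ 1) => j jk.
by rewrite /ek ltnS (leq_trans jk).
Qed.

(* With [m i] the mean of the first [i] entries of [u], the coefficient of [e_k] is
   [m k.+1 - m k.+2] and the sum telescopes. *)
Lemma ek_span n (u : 'I_n.+1 -> R) : \sum_j u j = 0 ->
  exists c : 'I_n -> R, forall j, \sum_(k < n) c k * @ek R n.+1 k j = u j.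
Proof.
move=> u0; pose v i := u (inord i); pose P m := \sum_(0 <= i < m) v i.
pose m i := P i / i%:R.
have Pn : P n.+1 = 0.
  by apply: etrans u0; rewrite /P big_mkord; apply: eq_bigr => i _; rewrite /v inord_val.
exists (fun k => m k.+1 - m k.+2) => j.
have -> : \sum_(k < n) (m k.+1 - m k.+2) * @ek R n.+1 k j =
    \sum_(0 <= k < n) (m k.+1 - m k.+2) * ekn k j.
  by rewrite big_mkord; apply: eq_bigr => k _; rewrite /ek -/(ekn k j).
have jn : (j <= n)%N by rewrite -ltnS.
have -> : u j = v j by rewrite /v inord_val.
move: (nat_of_ord j) jn => {}j jn.
have Pm i : m i.+1 * i.+1%:R = P i.+1 by rewrite divfK// pnatr_eq0.
have PS i : P i.+1 = P i + v i by rewrite /P big_nat_recr.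
(* Entry j of e_k is 1 for k >= j, - j for k = j - 1, and 0 for smaller k. The first range
   telescopes to m j.+1, as m n.+1 = 0. *)
rewrite (@big_cat_nat _ _ _ j)//=.
have -> : \sum_(j <= k < n) (m k.+1 - m k.+2) * ekn k j = m j.+1.
  have -> : \sum_(j <= k < n) (m k.+1 - m k.+2) * ekn k j =
      - \sum_(j <= k < n) (m k.+2 - m k.+1).
    rewrite -sumrN big_nat [RHS]big_nat; apply: eq_bigr => k /andP[jk _].
    by rewrite /ekn ltnS jk mulr1 opprB.
  rewrite (telescope_sumr (fun k => m k.+1))// opprB.
  by rewrite [X in _ - X]/m Pn mul0r subr0.
case: j jn => [|j] jn.
  by rewrite big_geq// add0r -[m 1]mulr1 Pm PS /P big_geq// add0r.
rewrite big_nat_recr//= big1_seq ?add0r; last first.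
  move=> k /andP[_]; rewrite mem_index_iota => /andP[_ kj].
  by rewrite /ekn ltnNge ltnS (ltnW kj)/= eqSS gtn_eqF// mulr0.
rewrite /ekn ltnn eqxx; have := Pm j; have := Pm j.+1; have := PS j.+1.
rewrite -[j.+2%:R]natr1 => h1 h2 h3.
apply: (@addrI _ (P j.+1)); rewrite -h1 -h2 -h3; ring.
Qed.

End Basis.

(** * Uniqueness of the weak derivative *)

Section WeakDerivativeUnique.
Variable R : realType.
Local Notation mu := (@lebesgue_measure R).
Local Notation HL := (@halfline R).
Local Notation msb A := (@measurable _ (measurableTypeR R) A).
Let mHL := @halfline_measurable R.
Implicit Types (v dv w dw : R -> R).

(** All integrals of [dw] from 0 vanish, so Lebesgue differentiation gives dw = 0 almost
    everywhere. *)
Lemma H1_zero_derivative w dw : H1 w dw -> (forall x, 0 <= x -> w x = 0) ->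
  hint (fun x => dw x ^+ 2) = 0.
Proof.
move=> Hw w0; have [_ sdw] := H1_sqi Hw.
suff Z n : \int[mu]_(x in `[0, n.+1%:R]) (dw x ^+ 2) = 0.
  apply: cvg_unique (Rint_0n_cvg sdw.2) _ => //=.
  suff -> : (fun n : nat => \int[mu]_(x in `[0, n.+1%:R]) dw x ^+ 2) = (fun=> 0).
    exact: cvg_cst.
  by apply/funext => n; exact: Z.
pose b : R := n.+1%:R; rewrite -/b; have b0 : 0 < b by rewrite /b.
have mA : msb `[0, b]%classic by [].
have [_ sb E] := H1_ac2 b Hw.
(* Extension by zero makes the function integrable on the whole line, as the differentiation theorem
   is applied there. *)
pose g := dw \_ `[0, b].
have Ib := sqi_itg sb.
have Lg : locally_integrable [set: R] g by exact: integrable_locally.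
have Ig : mu.-integrable setT (EFin \o g).
  by rewrite /g -restrict_EFin; apply/(integrable_mkcond _ mA).
have Igy (y : R) : mu.-integrable [set` Interval (BLeft 0) (BRight y)] (EFin \o g).
  by apply: integrableS Ig.
have F1 := FTC1 Igy Lg.
have Z0 (y : R) : 0 <= y -> y <= b -> \int[mu]_(t in [set` Interval (BLeft 0) (BRight y)]) g t = 0.
  move=> y0 yb; have Ey := E 0 y (lexx 0) y0 yb.
  rewrite (w0 _ y0) (w0 _ (lexx 0)) subrr in Ey; apply: etrans (esym Ey).
  apply: eq_Rintegral => t /set_mem /=; rewrite in_itv/= => /andP[t0 ty].
  by rewrite /g patchE mem_set//= in_itv/= t0 (le_trans ty yb).
have ae0 : {ae mu, forall x, `]0, b[%classic x -> dw x ^+ 2 = 0}.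
  apply: filterS F1; first exact: (ae_filter_ringOfSetsType mu).
  move=> x /= H; rewrite in_itv/= => /andP[x0 xb].
  have /H[_] : (0%:E < x%:E)%E by rewrite lte_fin.
  have -> : g x = dw x by rewrite /g patchE mem_set//= in_itv/= !ltW.
  move=> <-; rewrite derive1E (@near_eq_derive _ _ _ _ (cst 0)).
    by rewrite derive_cst expr0n.
  near=> y; apply: Z0.
    by apply: ltW; near: y; exact: lt_nbhsr.
  by apply: ltW; near: y; exact: lt_nbhsl.
have I2 : itg `[0, b] (fun x => dw x ^+ 2) by exact: sb.2.
have I3 : itg `]0, b] (fun x => dw x ^+ 2).
  by apply: itg_sub I2 => // x /=; rewrite !in_itv/= => /andP[/ltW -> ->].
have I4 : itg `]0, b[ (fun x => dw x ^+ 2).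
  by apply: itg_sub I2 => // x /=; rewrite !in_itv/= => /andP[/ltW -> /ltW ->].
rewrite -Rintegral_itv_obnd_cbnd// -Rintegral_itv_bndo_bndc//.
rewrite /Rintegral (@ae_eq_integral _ _ _ mu `]0, b[%classic (cst 0%E))//.
- by rewrite integral0.
- by apply/measurable_EFinP; exact: itg_measurable I4.
- apply: filterS ae0; first exact: (ae_filter_ringOfSetsType mu).
  by move=> x H xb; rewrite /= H.
Unshelve. all: by end_near. Qed.

(* The discriminant of [t |-> hint ((f + t * g) ^+ 2)]. *)
Lemma hint_mul0 f g : sqi HL f -> sqi HL g -> hint (fun x => g x ^+ 2) = 0 ->
  hint (fun x => f x * g x) = 0.
Proof.
move=> sf sg g0; have I := sqi_mul mHL sf sg.
set B := hint _; set A := hint (fun x => f x ^+ 2).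
have H (t : R) : 0 <= A + 2 * t * B.
  have : 0 <= hint (fun x => f x ^+ 2 + (2 * t * (f x * g x) + t ^+ 2 * g x ^+ 2)).
    by apply: hint_ge0 => x _; have := sqr_ge0 (f x + t * g x); nra.
  rewrite (hintD sf.2 (itgD mHL (itgZ (2 * t) mHL I) (itgZ (t ^+ 2) mHL sg.2))).
  rewrite (hintD (itgZ (2 * t) mHL I) (itgZ (t ^+ 2) mHL sg.2)) (hintZ _ I) (hintZ _ sg.2).
  by rewrite g0 mulr0 addr0.
(* As the quadratic coefficient is 0, the expression is affine in t, and this t would make it -
   1. *)
apply/eqP/negPn/negP => B0; have := H (- (A + 1) / (2 * B)).
have -> : A + 2 * (- (A + 1) / (2 * B)) * B = -1 by field.
by rewrite ler0N1.
Qed.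

(** With z = dv - dw, the two forms differ by 2 int dw z + int z^2, and both integrals vanish. *)
Lemma H1_form_unique (W v dv w dw : R -> R) (K : R) : continuous W -> (forall x, `|W x| <= K) ->
  H1 v dv -> H1 w dw -> (forall x, 0 <= x -> v x = w x) ->
  hint (fun x => dv x ^+ 2 + W x * v x ^+ 2) = hint (fun x => dw x ^+ 2 + W x * w x ^+ 2).
Proof.
move=> cW WK Hv Hw vw; have [sv sdv] := H1_sqi Hv; have [sw sdw] := H1_sqi Hw.
have Hz := H1_lin 1 (-1) Hv Hw; have [_ sdz] := H1_sqi Hz.
have z0 : hint (fun x => (1 * dv x + -1 * dw x) ^+ 2) = 0.
  by apply: (H1_zero_derivative Hz) => x x0; rewrite vw//; ring.
have c0 := hint_mul0 sdw sdz z0.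
have IW : itg HL (fun x => dw x ^+ 2 + W x * w x ^+ 2).
  apply: itgD mHL sdw.2 _; apply: (itg_bmul (c := K)) => //; last exact: sw.2.
  by apply: measurable_funTS; exact: continuous_measurable_fun.
have Ic := sqi_mul mHL sdw sdz.
have -> : hint (fun x => dv x ^+ 2 + W x * v x ^+ 2) =
    hint (fun x => (dw x ^+ 2 + W x * w x ^+ 2) + (2 * (dw x * (1 * dv x + -1 * dw x)) +
      (1 * dv x + -1 * dw x) ^+ 2)).
  by apply: eq_hint => x x0; rewrite vw//; ring.
rewrite (hintD IW (itgD mHL (itgZ 2 mHL Ic) sdz.2)) (hintD (itgZ 2 mHL Ic) sdz.2) (hintZ _ Ic).
by rewrite z0 c0 mulr0 !addr0.
Qed.

Lemma hint0 : hint (fun=> 0 : R) = 0.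
Proof. by rewrite /hint integral0. Qed.

Lemma sqi0 : sqi HL (fun=> 0 : R).
Proof.
split => //; rewrite (_ : (fun=> _) = (fun=> 0)); last by apply/funext => x; rewrite expr0n.
exact: integrable0.
Qed.

Lemma H1_0 : H1 (fun=> 0 : R) (fun=> 0 : R).
Proof.
apply: ac2_H1; [exact: sqi0..|move=> b]; split => //.
- apply: sqi_sub sqi0 => //; exact: itv_halfline.
- by move=> x y _ _ _; rewrite subrr /Rintegral integral0.
Qed.

End WeakDerivativeUnique.

(** * The star graph *)

Section Assembly.
Variables (R : realType) (p : R).
Hypothesis p_gt0 : 0 < p.
Local Notation HL := (@halfline R).
Let mHL := @halfline_measurable R.

Lemma derive1_phi : derive1 (phi p) = dphi p.
Proof. exact: is_derive_derive1 (is_derive_phi p_gt0). Qed.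

Lemma derive1_dphi : derive1 (dphi p) = d2phi p.
Proof. exact: is_derive_derive1 (is_derive_dphi p_gt0). Qed.

Lemma is_derive_sumf n (h : 'I_n -> R -> R) (dh : 'I_n -> R) (x : R) :
  (forall i, is_derive x 1 (h i) (dh i)) ->
  is_derive x 1 (fun y => \sum_(i < n) h i y) (\sum_(i < n) dh i).
Proof. by move=> H; have := is_derive_sum H; rewrite fct_sumE. Qed.

(** Integration by parts with (phi')'' = W+ phi' leaves the boundary term phi' phi'', which vanishes
    at infinity by decay and at the vertex because phi' 0 = 0. *)
Lemma Qplus_dphi_eq0 : Qplus p (dphi p) (d2phi p) = 0.
Proof.
have H := H1_dphi p_gt0; have H2 := H1_phi p_gt0.
have I := itg_bilinear p_gt0 H H.
have -> : Qplus p (dphi p) (d2phi p) =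
    hint (fun x => d2phi p x * d2phi p x + Wplus p x * (dphi p x * dphi p x)).
  by apply: eq_hint => x _; rewrite !expr2.
have C1 := Rint_0n_cvg I.
have C2 : dphi p n.+1%:R * d2phi p n.+1%:R @[n --> \oo] --> (0 : R).
  have C3 : (p + 2) * phi p n.+1%:R ^+ 2 @[n --> \oo] --> (0 : R).
    by rewrite -[X in _ --> X](mulr0 (p + 2)); apply: cvgMr; exact: H1_decay H2.
  apply: norm_cvg0; apply: (squeeze_cvgr _ (cvg_cst 0) C3); apply: nearW => n.
  rewrite normr_ge0/= normrM expr2 mulrCA; apply: ler_pM => //.
    exact: dphi_norm_le.
  exact: d2phi_norm_le.
apply: cvg_unique C2 => //=.
suff <- : (fun n : nat => \int[lebesgue_measure]_(x in `[0, n.+1%:R]) (d2phi p x * d2phi p x +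
    Wplus p x * (dphi p x * dphi p x))) = (fun n : nat => dphi p n.+1%:R * d2phi p n.+1%:R) by [].
apply/funext => n.
have A2 : ac2 0 n.+1%:R (d2phi p) (fun x => Wplus p x * dphi p x).
  apply: ac2_C1 => x _; first exact: is_derive_d2phi.
  apply: continuousM; first exact: continuous_Wplus.
  exact: is_derive_continuous (is_derive_dphi p_gt0 x).
have [_ _ E] := ac2_mul (H1_ac2 n.+1%:R H) A2.
have E0 : dphi p 0 * d2phi p 0 = 0 by rewrite dphi0 mul0r.
apply: etrans (etrans (congr1 (fun z => dphi p n.+1%:R * d2phi p n.+1%:R - z) E0) (subr0 _)).
apply: etrans (esym (E 0 n.+1%:R (lexx 0) (ler0n _ _) (lexx _))).
by apply: eq_Rintegral => x _; ring.
Qed.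

(** Phi is real, so no mixed term survives at s = 0: the nonlinearity contributes 2 (p + 1) phi^(2p)
    ((2 p + 1) a^2 + b^2), with a and b the real and imaginary parts. *)
Lemma second_varE N (V dV : gfun R N) : in_H1 V dV ->
  second_var p V dV = 2 * \sum_(j < N)
    (Qplus p (fun x => (V j x).1) (fun x => (dV j x).1) +
     Qminus p (fun x => (V j x).2) (fun x => (dV j x).2)).
Proof.
move=> HV.
have [sf sdf] := H1_sqi (H1_phi p_gt0).
pose a (j : 'I_N) (x : R) := (V j x).1; pose b (j : 'I_N) (x : R) := (V j x).2.
pose da (j : 'I_N) (x : R) := (dV j x).1; pose db (j : 'I_N) (x : R) := (dV j x).2.
have Ha j : H1 (a j) (da j) by have [] := HV j.
have Hb j : H1 (b j) (db j) by have [] := HV j.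
pose L (j : 'I_N) (s : R) := hint (fun x => quad (dphi p x) (da j x) (db j x) s)
  - hint (fun x => powR (quad (phi p x) (a j x) (b j x) s) (p + 1))
  + hint (fun x => quad (phi p x) (a j x) (b j x) s).
pose F1 (j : 'I_N) (s : R) := hint (fun x => (p + 1) *
  (powR (quad (phi p x) (a j x) (b j x) s) p * dquad (phi p x) (a j x) (b j x) s)).
pose L1 (j : 'I_N) (s : R) :=
  (2 * hint (fun x => dphi p x * da j x) + 2 * s * hint (fun x => da j x ^+ 2 + db j x ^+ 2))
  - F1 j s
  + (2 * hint (fun x => phi p x * a j x) + 2 * s * hint (fun x => a j x ^+ 2 + b j x ^+ 2)).
pose F2 (j : 'I_N) := hint (fun x => (p + 1) *
  (powR (phi p x ^+ 2) p * ((4 * p + 2) * a j x ^+ 2 + 2 * b j x ^+ 2))).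
pose L2 (j : 'I_N) := 2 * hint (fun x => da j x ^+ 2 + db j x ^+ 2) - F2 j
  + 2 * hint (fun x => a j x ^+ 2 + b j x ^+ 2).
have bnd (j : 'I_N) : exists M : R, [/\ 0 <= M, (forall x, 0 <= x -> `|phi p x| <= M),
    (forall x, 0 <= x -> `|a j x| <= M) & (forall x, 0 <= x -> `|b j x| <= M)].
  have [M1 [M10 h1]] := H1_bounded (H1_phi p_gt0).
  have [M2 [M20 h2]] := H1_bounded (Ha j).
  have [M3 [M30 h3]] := H1_bounded (Hb j).
  exists (M1 + M2 + M3); split; first by rewrite !addr_ge0.
  - by move=> x x0; have := h1 x x0; lra.
  - by move=> x x0; have := h2 x x0; lra.
  - by move=> x x0; have := h3 x x0; lra.
(* The first derivative is needed at every s, because [derive1] is applied to a function that is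
   itself a [derive1]; the second only at 0. The sup bounds in [bnd] feed the domination. *)
have DL (j : 'I_N) (s : R) : is_derive s 1 (L j) (L1 j s).
  have [M [M0 h1 h2 h3]] := bnd j.
  have [sa sda] := H1_sqi (Ha j); have [sb sdb] := H1_sqi (Hb j).
  exact: (is_derive_addf (is_derive_subf (is_derive_hint_quad s sdf sda sdb)
    (is_derive_hint_powS p_gt0 sf sa sb M0 h1 h2 h3 s)) (is_derive_hint_quad s sf sa sb)).
have DL1 (j : 'I_N) : is_derive (0 : R) 1 (L1 j) (L2 j).
  have [M [M0 h1 h2 h3]] := bnd j.
  have [sa sda] := H1_sqi (Ha j); have [sb sdb] := H1_sqi (Hb j).
  have lin (u w : R) : is_derive (0 : R) 1 (fun s => u + 2 * s * w) (2 * w).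
    have := is_derive_addf (is_derive_cstf u 0) (is_derive_mulf
      (is_derive_scalef 2 (is_derive_idf 0)) (is_derive_cstf w 0)).
    by move/is_derive_eq; apply; ring.
  exact: (is_derive_addf (is_derive_subf (lin _ _)
    (is_derive_hint_pow_dquad p_gt0 sf sa sb M0 h1 h2 h3)) (lin _ _)).
have D2 : is_derive (0 : R) 1 (fun s => \sum_(j < N) L1 j s) (\sum_(j < N) L2 j).
  exact: is_derive_sumf.
have E1 : derive1 (fun s : R => \sum_(j < N) L j s) = (fun s => \sum_(j < N) L1 j s).
  by apply: is_derive_derive1 => s; exact: is_derive_sumf.
rewrite /second_var.
have -> : (fun s : R => Lambda p (gadd (@Phi R p N) (gscale s V)) (gadd (@dPhi R p N) (gscale s dV)))
    = (fun s => \sum_(j < N) L j s).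
  by apply/funext => s; rewrite /Lambda /dPhi derive1_phi.
rewrite E1 derive1E; have [_ ->] := D2; rewrite mulr_sumr.
apply: eq_bigr => j _; rewrite /L2 /F2.
have [sa sda] := H1_sqi (Ha j); have [sb sdb] := H1_sqi (Hb j).
have IT (u : R -> R) : sqi HL u -> itg HL (fun x => (1 - tanhp p x ^+ 2) * u x ^+ 2).
  move=> su; apply: (itg_bmul (c := 1)) => //; last exact: su.2.
  - apply: measurable_funTS; apply: continuous_measurable_fun => x.
    exact: is_derive_continuous (is_derive_subf (is_derive_cstf 1 x)
      (is_derive_sqrf (is_derive_tanhp p x))).
  - move=> x _; have := tanhp_sqr_le1 p x; have := sqr_ge0 (tanhp p x).
    by move=> ? ?; rewrite ler_norml; apply/andP; split; lra.
have Ia := IT _ sa; have Ib := IT _ sb.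
have -> : hint (fun x => (p + 1) * (powR (phi p x ^+ 2) p *
     ((4 * p + 2) * a j x ^+ 2 + 2 * b j x ^+ 2))) =
   2 * (p + 1) * (2 * p + 1) * hint (fun x => (1 - tanhp p x ^+ 2) * a j x ^+ 2) +
   2 * (p + 1) * hint (fun x => (1 - tanhp p x ^+ 2) * b j x ^+ 2).
  rewrite -(hintZ (2 * (p + 1) * (2 * p + 1)) Ia) -(hintZ (2 * (p + 1)) Ib).
  rewrite -(hintD (itgZ _ mHL Ia) (itgZ _ mHL Ib)).
  by apply: eq_hint => x _; rewrite powR_phi//; ring.
have -> : Qplus p (a j) (da j) = hint (fun x => da j x ^+ 2) + (hint (fun x => a j x ^+ 2)
    + (- ((p + 1) * (2 * p + 1))) * hint (fun x => (1 - tanhp p x ^+ 2) * a j x ^+ 2)).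
  rewrite -(hintZ _ Ia) -(hintD sa.2 (itgZ _ mHL Ia)).
  rewrite -(hintD sda.2 (itgD mHL sa.2 (itgZ _ mHL Ia))).
  by apply: eq_hint => x _; rewrite /Wplus; ring.
have -> : Qminus p (b j) (db j) = hint (fun x => db j x ^+ 2) + (hint (fun x => b j x ^+ 2)
    + (- (p + 1)) * hint (fun x => (1 - tanhp p x ^+ 2) * b j x ^+ 2)).
  rewrite -(hintZ _ Ib) -(hintD sb.2 (itgZ _ mHL Ib)).
  rewrite -(hintD sdb.2 (itgD mHL sb.2 (itgZ _ mHL Ib))).
  by apply: eq_hint => x _; rewrite /Wminus; ring.
rewrite (hintD sda.2 sdb.2) (hintD sa.2 sb.2); ring.
Qed.

(** Orthogonality constrains only the sum over the edges, so the cross terms cancel because one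
    constant c serves all edges, which is continuity at the vertex. *)
Lemma sum_Qplus n (a da : 'I_n -> R -> R) (alpha : R) :
  (forall j, H1 (a j) (da j)) -> (forall j, a j 0 = alpha) ->
  \sum_(j < n) hint (fun x => a j x * phi p x) = 0 ->
  \sum_(j < n) Qplus p (a j) (da j) =
  \sum_(j < n) Qplus p (fun x => 1 * a j x + - (alpha / theta p 0) * theta p x)
                       (fun x => 1 * da j x + - (alpha / theta p 0) * dtheta p x)
  + n%:R * ((alpha / theta p 0) ^+ 2 * hint (fun x => theta p x * phi p x)).
Proof.
move=> Ha a0 orth; set c := alpha / theta p 0.
under eq_bigr => j _ do rewrite (Qplus_shift p_gt0 c (Ha j)).
rewrite !big_split/= sumr_const card_ord; congr (_ + _); last by rewrite mulr_natl.
by rewrite sumrN -mulr_sumr orth mulr0 subr0.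
Qed.

Lemma shift_vertex a da (alpha : R) : H1 a da -> a 0 = alpha ->
  let c := alpha / theta p 0 in
  H1 (fun x => 1 * a x + - c * theta p x) (fun x => 1 * da x + - c * dtheta p x) /\
  1 * a 0 + - c * theta p 0 = 0.
Proof.
move=> Ha a0 c; split; first exact: H1_lin Ha (H1_theta p_gt0).
have t0 : theta p 0 != 0 by rewrite gt_eqF// theta0_gt0.
by rewrite a0 mulNr divfK// mul1r subrr.
Qed.

Lemma sum_Qplus_ge0 n (a da : 'I_n -> R -> R) (alpha : R) : p < 2 ->
  (forall j, H1 (a j) (da j)) -> (forall j, a j 0 = alpha) ->
  \sum_(j < n) hint (fun x => a j x * phi p x) = 0 ->
  0 <= \sum_(j < n) Qplus p (a j) (da j).
Proof.
move=> p2 Ha a0 orth; rewrite (sum_Qplus Ha a0 orth) addr_ge0//.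
  by apply: sumr_ge0 => j _; have [? ?] := shift_vertex (Ha j) (a0 j); exact: Qplus_ge0.
by rewrite mulr_ge0// mulr_ge0 ?sqr_ge0// ltW// hint_theta_phi_gt0.
Qed.

(** Positivity of <theta, phi> forces c = 0, hence every edge lies separately in the kernel and a_j
    = u_j phi'. Orthogonality then reads (sum of the u_j) <phi', phi> = 0 with a nonzero second
    factor. *)
Lemma sum_Qplus_eq0 n (a da : 'I_n.+1 -> R -> R) (alpha : R) : p < 2 ->
  (forall j, H1 (a j) (da j)) -> (forall j, a j 0 = alpha) ->
  \sum_(j < n.+1) hint (fun x => a j x * phi p x) = 0 ->
  \sum_(j < n.+1) Qplus p (a j) (da j) = 0 ->
  exists u : 'I_n.+1 -> R, \sum_j u j = 0 /\ forall j x, 0 <= x -> a j x = u j * dphi p x.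
Proof.
move=> p2 Ha a0 orth; rewrite (sum_Qplus Ha a0 orth).
set c := alpha / theta p 0.
have Qge j : 0 <= Qplus p (fun x => 1 * a j x + - c * theta p x)
    (fun x => 1 * da j x + - c * dtheta p x).
  by have [? ?] := shift_vertex (Ha j) (a0 j); exact: Qplus_ge0.
have T0 := hint_theta_phi_gt0 p_gt0 p2.
have n0 : 0 < n.+1%:R :> R by [].
move/eqP; rewrite paddr_eq0; last 2 first.
- exact: sumr_ge0.
- by rewrite mulr_ge0// mulr_ge0 ?sqr_ge0// ltW.
move=> /andP[/eqP Q0]; rewrite mulf_eq0 gt_eqF//= mulf_eq0 [X in _ || X]gt_eqF// orbF.
rewrite sqrf_eq0 => /eqP c0.
have exu j : exists u, forall x, 0 <= x -> a j x = u * dphi p x.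
  have [Hv v0] := shift_vertex (Ha j) (a0 j).
  have Qj := psumr_eq0P (fun i _ => Qge i) Q0; have [u Hu] := Qplus_eq0 p_gt0 Hv v0 (Qj j isT).
  exists u => x x0; have := Hu x x0; rewrite -/c c0 => <-; ring.
have [u Hu] := choice exu.
exists u; split => //.
have [sf sdf] := H1_sqi (H1_phi p_gt0); have I := sqi_mul mHL sdf sf.
move: orth; rewrite (eq_bigr (fun j => u j * hint (fun x => dphi p x * phi p x))); last first.
  by move=> j _; rewrite -(hintZ _ I); apply: eq_hint => x x0; rewrite Hu// mulrA.
rewrite -mulr_suml hint_phi_dphi// => /eqP; rewrite mulf_eq0 => /orP[/eqP//|].
by rewrite oppr_eq0 mulf_eq0 sqrf_eq0 gt_eqF ?phi_gt0// invr_eq0 pnatr_eq0.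
Qed.

(** Each b_j is a multiple of phi, and since phi 0 is nonzero, continuity at the vertex makes the
    multiple common; orthogonality to Phi then kills it. *)
Lemma sum_Qminus_eq0 n (b db : 'I_n.+1 -> R -> R) (beta : R) :
  (forall j, H1 (b j) (db j)) -> (forall j, b j 0 = beta) ->
  \sum_(j < n.+1) hint (fun x => b j x * phi p x) = 0 ->
  \sum_(j < n.+1) Qminus p (b j) (db j) = 0 ->
  forall j x, 0 <= x -> b j x = 0.
Proof.
move=> Hb b0 orth Q0.
have Qge j : 0 <= Qminus p (b j) (db j) by exact: Qminus_ge0.
pose c := beta / phi p 0; have f0 := phi_gt0 p 0.
have Hc j x : 0 <= x -> b j x = c * phi p x.
  have Qj := psumr_eq0P (fun i _ => Qge i) Q0; have [u Hu] := Qminus_eq0 p_gt0 (Hb j) (Qj j isT).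
  suff -> : c = u by exact: Hu.
  by rewrite /c -(b0 j) Hu// mulfK// gt_eqF.
have [sf sdf] := H1_sqi (H1_phi p_gt0).
move: orth; rewrite (eq_bigr (fun=> c * hint (fun x => phi p x ^+ 2))); last first.
  by move=> j _; rewrite -(hintZ _ sf.2); apply: eq_hint => x x0; rewrite Hc// expr2 mulrA.
rewrite sumr_const card_ord -mulr_natl => /eqP.
rewrite mulf_eq0 pnatr_eq0/= mulf_eq0 [X in _ || X]gt_eqF ?hint_phi2_gt0// orbF => /eqP c0.
by move=> j x x0; rewrite Hc// c0 mul0r.
Qed.

End Assembly.

Theorem theorem2p1 (R : realType) (N : nat) (p : R) :
  (3 <= N)%N -> 0 < p -> p < 2 ->
  (* nonnegativity on H^1_Gamma cap L^2_c *)
  (forall V dV : gfun R N, in_H1_Gamma V dV -> L2orth V (Phi p N) ->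
     0 <= second_var p V dV)
  /\
  (* characterization of the kernel *)
  (forall V dV : gfun R N, in_H1_Gamma V dV -> L2orth V (Phi p N) ->
     (second_var p V dV = 0 <-> in_span_U p V))
  /\
  (* the U^(k) lie in H^1_Gamma cap L^2_c, are nonzero and pairwise L2orth,
     so they span an (N-1)-dimensional subspace *)
  (forall k : 'I_(N.-1),
     in_H1_Gamma (U p k) (dU p k) /\ L2orth (U p k) (Phi p N) /\
     0 < ip_re (U p k) (U p k))
  /\
  (forall k l : 'I_(N.-1), k != l -> L2orth (U p k) (U p l)).
Proof.
case: N => [//|n] _ p0 p2.
have mHL := @halfline_measurable R.
have [sf sdf] := H1_sqi (H1_phi p0).
have I := sqi_mul mHL sdf sf.
have edge (V dV : gfun R n.+1) : in_H1_Gamma V dV -> L2orth V (Phi p n.+1) ->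
    [/\ forall j, H1 (fun x => (V j x).1) (fun x => (dV j x).1),
        forall j, (V j 0).1 = (V ord0 0).1,
        \sum_(j < n.+1) hint (fun x => (V j x).1 * phi p x) = 0 &
        [/\ forall j, H1 (fun x => (V j x).2) (fun x => (dV j x).2),
        forall j, (V j 0).2 = (V ord0 0).2 &
        \sum_(j < n.+1) hint (fun x => (V j x).2 * phi p x) = 0]].
  move=> [HV V0] [ore oim]; split; [by move=> j; have [] := HV j|by move=> j; rewrite (V0 j ord0)| |].
    rewrite -[RHS]ore; apply: eq_bigr => j _; apply: eq_hint => x _.
    by rewrite /Phi/= mulr0 addr0.
  split; [by move=> j; have [] := HV j|by move=> j; rewrite (V0 j ord0)|].
  rewrite -[RHS]oim; apply: eq_bigr => j _; apply: eq_hint => x _.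
  by rewrite /Phi/= mulr0 subr0.
have UE (k : 'I_n) j x : @U R p n.+1 k j x = (@ek R n.+1 k j * dphi p x, 0).
  by rewrite /U derive1_phi.
have sumU (g : 'I_n.+1 -> R) (h : R -> R) : itg (@halfline R) h ->
    \sum_(j < n.+1) hint (fun x => g j * h x) = (\sum_j g j) * hint h.
  by move=> Ih; rewrite mulr_suml; apply: eq_bigr => j _; rewrite hintZ.
have sum0 (h : 'I_n.+1 -> R -> R) : (forall j x, h j x = 0) -> \sum_(j < n.+1) hint (h j) = 0.
  move=> h0; rewrite big1// => j _; rewrite -[RHS](hint0 R).
  by apply: eq_hint => x _; exact: h0.
split; [|split; [|split]].
- move=> V dV HV oV; have [Ha a0 oa [Hb b0 ob]] := edge V dV HV oV.
  rewrite (second_varE p0 HV.1) mulr_ge0// big_split/= addr_ge0//.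
    exact: sum_Qplus_ge0 p2 Ha a0 oa.
  by apply: sumr_ge0 => j _; exact: Qminus_ge0.
- move=> V dV HV oV; have [Ha a0 oa [Hb b0 ob]] := edge V dV HV oV.
  rewrite (second_varE p0 HV.1) big_split/=.
  have Qa := sum_Qplus_ge0 p0 p2 Ha a0 oa.
  have Qb : 0 <= \sum_(j < n.+1) Qminus p (fun x => (V j x).2) (fun x => (dV j x).2).
    by apply: sumr_ge0 => j _; exact: Qminus_ge0.
  split.
    move/eqP; rewrite mulf_eq0 pnatr_eq0/= paddr_eq0// => /andP[/eqP Qa0 /eqP Qb0].
    have [u [u0 au]] := sum_Qplus_eq0 p0 p2 Ha a0 oa Qa0.
    have bz := sum_Qminus_eq0 p0 Hb b0 ob Qb0.
    have [c cu] := ek_span u0.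
    exists c => j x x0; have := au j x x0; have := bz j x x0.
    rewrite [V j x]surjective_pairing/= => -> ->; congr (_, _).
    rewrite -cu mulr_suml; apply: eq_bigr => k _.
    by rewrite derive1_phi// mulrA.
  (* On the span Re V_j = u_j phi' and Im V_j = 0, and [H1_form_unique] exchanges the given [dV] for
     the classical derivative. The shape [1 * 0 + u j * _] is what [H1_lin] produces from the zero
     function. *)
  move=> [c Vc]; pose u j := \sum_(k < n) c k * @ek R n.+1 k j.
  have Va j x : 0 <= x -> (V j x).1 = 1 * 0 + u j * dphi p x.
    move=> x0; rewrite Vc//= mulr0 add0r mulr_suml; apply: eq_bigr => k _.
    by rewrite derive1_phi// mulrA.
  have Vb j x : 0 <= x -> (V j x).2 = 0 by move=> x0; rewrite Vc.
  rewrite big1 ?big1 ?addr0 ?mulr0// => j _.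
    have -> : Qminus p (fun x => (V j x).2) (fun x => (dV j x).2) =
        Qminus p (fun=> 0) (fun=> 0).
      exact: (H1_form_unique (@continuous_Wminus R p) (Wminus_norm_le p0) (Hb j) (H1_0 R) (Vb j)).
    by apply: etrans (hint0 R); apply: eq_hint => x _; ring.
  have -> : Qplus p (fun x => (V j x).1) (fun x => (dV j x).1) =
      Qplus p (fun x => 1 * 0 + u j * dphi p x) (fun x => 1 * 0 + u j * d2phi p x).
    exact: (H1_form_unique (@continuous_Wplus R p) (Wplus_norm_le p0) (Ha j)
      (H1_lin 1 (u j) (H1_0 R) (H1_dphi p0)) (Va j)).
  have IQ := itg_bilinear p0 (H1_dphi p0) (H1_dphi p0).
  have -> : Qplus p (fun x => 1 * 0 + u j * dphi p x) (fun x => 1 * 0 + u j * d2phi p x) =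
      hint (fun x => u j ^+ 2 * (d2phi p x * d2phi p x + Wplus p x * (dphi p x * dphi p x))).
    by apply: eq_hint => x _; ring.
  have Z : hint (fun x => d2phi p x * d2phi p x + Wplus p x * (dphi p x * dphi p x)) = 0.
    by apply: etrans (Qplus_dphi_eq0 p0); apply: eq_hint => x _; rewrite !expr2.
  by rewrite (hintZ _ IQ) Z mulr0.
- move=> k; split; [split; [|]|split; [split|]].
  + move=> j; rewrite /U /dU derive1_phi// derive1_dphi//; split; last exact: H1_0.
    have := H1_lin 1 (@ek R n.+1 k j) (H1_0 R) (H1_dphi p0).
    set f1 := fun x => _ + _; set f2 := fun x => _ + _.
    have -> : f1 = (fun x => @ek R n.+1 k j * dphi p x) by apply/funext => x; rewrite /f1; ring.
    by have -> : f2 = (fun x => @ek R n.+1 k j * d2phi p x) by apply/funext => x; rewrite /f2; ring.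
  + by move=> i j; rewrite !UE dphi0 !mulr0.
  + rewrite -[RHS](mul0r (hint (fun x => dphi p x * phi p x))) -(sum_ek R k) -sumU//.
    by apply: eq_bigr => j _; apply: eq_hint => x _; rewrite UE /Phi/=; ring.
  + by apply: sum0 => j x; rewrite UE /Phi/=; ring.
  + have -> : ip_re (U p k) (U p k) =
        (\sum_j @ek R n.+1 k j ^+ 2) * hint (fun x => dphi p x ^+ 2).
      rewrite -sumU; last exact: sdf.2.
      by apply: eq_bigr => j _; apply: eq_hint => x _; rewrite UE/=; ring.
    apply: mulr_gt0; last exact: hint_dphi2_gt0.
    (* Entry 0 of every e_k is 1, which makes the sum of squares positive. *)
    rewrite big_ord_recl ltr_pwDl//; first by rewrite /ek/= expr1n.
    by apply: sumr_ge0 => j _; exact: sqr_ge0.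
- move=> k l kl; split; last by apply: sum0 => j x; rewrite !UE/=; ring.
  rewrite -[RHS](mul0r (hint (fun x => dphi p x ^+ 2))) -(sum_ek_orth R kl) -sumU; last exact: sdf.2.
  by apply: eq_bigr => j _; apply: eq_hint => x _; rewrite !UE/=; ring.
Qed.
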